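(* Let $\mathcal{N}_{A'B'\to AB}$ be a tele-covariant bipartite quantum channel with $|A'|<\infty$. Then $$S[A|B]_{\mathcal{N}}=S(R_AA|R_BB)_{\Phi^{\mathcal{N}}}-\log|A'|,$$ where $\Phi^{\mathcal{N}}_{R_AAR_BB}:=\mathcal{N}(\Phi_{R_AA'}\otimes\Phi_{R_BB'})$ is the Choi state, $R_A\simeq A'$, $R_B\simeq B'$.
   Context: Systems are finite-dimensional. $\Phi_{RX}$ denotes the normalized maximally entangled state. $D(\rho\Vert\sigma)$ is the Umegaki relative entropy; for a channel $\mathcal{K}$ and completely positive map $\mathcal{L}$ from $X'$ to $X$, $D[\mathcal{K}\Vert\mathcal{L}]:=\sup_{\rho_{RX'}}D((\mathrm{id}_R\otimes\mathcal{K})(\rho)\Vert(\mathrm{id}_R\otimes\mathcal{L})(\rho))$. $\mathcal{R}_{A'\to A}(Y)=\operatorname{tr}(Y)\mathbbm{1}_A$. Von Neumann conditional entropy of a bipartite channel: $S[A|B]_{\mathcal{N}}:=-\inf_{\mathcal{M}\in\mathrm{Q}(B',B)}D[\mathcal{N}\Vert\mathcal{R}_{A'\to A}\otimes\mathcal{M}_{B'\to B}]$. For states, $S(X|Y)_\omega=S(XY)_\omega-S(Y)_\omega$. A bipartite channel $\mathcal{N}_{A'B'\to AB}$ is tele-covariant if there are finite groups $G,H$ with unitary representations $g\mapsto U^g_{A'}$, $h\mapsto U^h_{B'}$ that are unitary one-designs ($\frac{1}{|G|}\sum_g U^gXU^{g\dagger}=\operatorname{tr}(X)\mathbbm{1}_{A'}/|A'|$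 and similarly for $B'$), and unitary representations $V^g_A$, $W^h_B$, such that $\mathcal{N}((U^g\otimes U^h)\rho(U^g\otimes U^h)^\dagger)=(V^g\otimes W^h)\mathcal{N}(\rho)(V^g\otimes W^h)^\dagger$ for all states $\rho$ and all $g,h$. *)

(* Defs.v *)
From HB Require Import structures.
From mathcomp Require Import all_boot all_order all_algebra all_fingroup.
From mathcomp Require Import complex.
From mathcomp Require Import boolp classical_sets reals constructive_ereal ereal exp.
Set Implicit Arguments. Unset Strict Implicit. Unset Printing Implicit Defensive.
Import Order.TTheory GRing.Theory Num.Theory.
Local Open Scope ring_scope.
Local Open Scope classical_set_scope.

Section Quantum.
Variable R : realType.
Local Notation C := (R[i]).

(* index of the product basis vector |i>|j> in a bipartite system m*n *)
Definition pidx (m n : nat) (i : 'I_m) (j : 'I_n) : 'I_(m * n) := mxvec_index i j.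

Definition adjmx (m n : nat) (A : 'M[C]_(m, n)) : 'M[C]_(n, m) := (map_mx conjc A)^T.

Definition unitarymx (n : nat) (U : 'M[C]_n) : Prop := U *m adjmx U = 1%:M.

(* positive semidefinite: <v|A|v> >= 0 for all v (order of C: real and >= 0) *)
Definition psdmx (n : nat) (A : 'M[C]_n) : Prop :=
  forall v : 'cV[C]_n, 0 <= (adjmx v *m A *m v) 0 0.

Definition state (n : nat) (rho : 'M[C]_n) : Prop := psdmx rho /\ \tr rho = 1.

Definition tensmx (m1 n1 m2 n2 : nat) (A : 'M[C]_(m1, n1)) (B : 'M[C]_(m2, n2))
  : 'M[C]_(m1 * m2, n1 * n2) :=
  \sum_(i < m1) \sum_(j < n1) \sum_(k < m2) \sum_(l < n2)
     (A i j * B k l) *: delta_mx (pidx i k) (pidx j l).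

Definition ptrace1 (m n : nat) (X : 'M[C]_(m * n)) : 'M[C]_n :=
  \matrix_(k, l) \sum_(i < m) X (pidx i k) (pidx i l).

Definition tmap (m1 m2 n1 n2 : nat) (K : 'M[C]_m1 -> 'M[C]_m2)
  (L : 'M[C]_n1 -> 'M[C]_n2) (X : 'M[C]_(m1 * n1)) : 'M[C]_(m2 * n2) :=
  \sum_(i < m1) \sum_(j < m1) \sum_(k < n1) \sum_(l < n1)
     X (pidx i k) (pidx j l) *: tensmx (K (delta_mx i j)) (L (delta_mx k l)).

Definition idtensor (r m1 m2 : nat) (K : 'M[C]_m1 -> 'M[C]_m2) :
  'M[C]_(r * m1) -> 'M[C]_(r * m2) := tmap (@id 'M[C]_r) K.

Definition mid_swap (p q s t : nat) (X : 'M[C]_((p * q) * (s * t))) :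
  'M[C]_((p * s) * (q * t)) :=
  \sum_(a < p) \sum_(a' < p) \sum_(b < q) \sum_(b' < q)
  \sum_(c < s) \sum_(c' < s) \sum_(d < t) \sum_(d' < t)
    X (pidx (pidx a b) (pidx c d)) (pidx (pidx a' b') (pidx c' d')) *:
      delta_mx (pidx (pidx a c) (pidx b d)) (pidx (pidx a' c') (pidx b' d')).

Definition maxent (n : nat) : 'M[C]_(n * n) :=
  n%:R^-1 *: \sum_(i < n) \sum_(j < n) delta_mx (pidx i i) (pidx j j).

Definition cpmap (m n : nat) (K : 'M[C]_m -> 'M[C]_n) : Prop :=
  linear K /\
  forall (r : nat) (X : 'M[C]_(r * m)), psdmx X -> psdmx (@idtensor r m n K X).

Definition channel (m n : nat) (K : 'M[C]_m -> 'M[C]_n) : Prop :=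
  cpmap K /\ forall X : 'M[C]_m, \tr (K X) = \tr X.

Definition Rmap (m n : nat) (Y : 'M[C]_m) : 'M[C]_n := (\tr Y) *: 1%:M.

Definition eigdec (n : nat) (A : 'M[C]_n) (p : 'M[C]_n * 'rV[R]_n) : Prop :=
  unitarymx p.1 /\ A = p.1 *m diag_mx (map_mx (fun x => (x%:C)%C) p.2) *m adjmx p.1.

Definition mxfun (f : R -> R) (n : nat) (A : 'M[C]_n) : 'M[C]_n :=
  let p := xget (0, 0) [set p | eigdec A p] in
  p.1 *m diag_mx (map_mx (fun x => ((f x)%:C)%C) p.2) *m adjmx p.1.

Definition logsupp (x : R) : R := if 0 < x then ln x else 0.
Definition mxlog (n : nat) (A : 'M[C]_n) : 'M[C]_n := mxfun logsupp A.

Definition supp_le (n : nat) (rho sigma : 'M[C]_n) : Prop :=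
  forall v : 'cV[C]_n, sigma *m v = 0 -> rho *m v = 0.

Definition relent (n : nat) (rho sigma : 'M[C]_n) : \bar R :=
  if `[< supp_le rho sigma >]
  then (complex.Re (\tr (rho *m (mxlog rho - mxlog sigma))))%:E
  else +oo%E.

Definition vNentropy (n : nat) (rho : 'M[C]_n) : R :=
  - complex.Re (\tr (rho *m mxlog rho)).

Definition condentropy (m n : nat) (omega : 'M[C]_(m * n)) : R :=
  vNentropy omega - vNentropy (ptrace1 omega).

Definition chdiv (m n : nat) (K L : 'M[C]_m -> 'M[C]_n) : \bar R :=
  ereal_sup [set x | exists (r : nat) (rho : 'M[C]_(r * m)),
     state rho /\ x = relent (@idtensor r m n K rho) (@idtensor r m n L rho)].

Definition chcondentropy (a' b' a b : nat)
  (N : 'M[C]_(a' * b') -> 'M[C]_(a * b)) : \bar R :=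
  (- ereal_inf [set x | exists M : 'M[C]_b' -> 'M[C]_b,
      channel M /\ x = chdiv N (tmap (@Rmap a' a) M)])%E.

Definition choi (a' b' a b : nat) (N : 'M[C]_(a' * b') -> 'M[C]_(a * b)) :
  'M[C]_((a' * a) * (b' * b)) :=
  mid_swap (@idtensor (a' * b') _ _ N (mid_swap (tensmx (maxent a') (maxent b')))).

Definition unitary_rep (G : finGroupType) (n : nat) (U : G -> 'M[C]_n) : Prop :=
  (forall g, unitarymx (U g)) /\ U 1%g = 1%:M /\
  (forall g h, U (g * h)%g = U g *m U h).

Definition one_design (G : finGroupType) (n : nat) (U : G -> 'M[C]_n) : Prop :=
  forall X : 'M[C]_n,
    #|G|%:R^-1 *: \sum_(g : G) (U g *m X *m adjmx (U g)) = (\tr X / n%:R) *: 1%:M.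

Definition tele_covariant (a' b' a b : nat)
  (N : 'M[C]_(a' * b') -> 'M[C]_(a * b)) : Prop :=
  exists (G H : finGroupType) (UA : G -> 'M[C]_a') (UB : H -> 'M[C]_b')
         (VA : G -> 'M[C]_a) (WB : H -> 'M[C]_b),
    [/\ unitary_rep UA, unitary_rep UB, unitary_rep VA, unitary_rep WB
        & [/\ one_design UA, one_design UB &
        forall (g : G) (h : H) (rho : 'M[C]_(a' * b')), state rho ->
          N (tensmx (UA g) (UB h) *m rho *m adjmx (tensmx (UA g) (UB h))) =
          tensmx (VA g) (WB h) *m N rho *m adjmx (tensmx (VA g) (WB h))]].

End Quantum.

(* Main.v *)
Require Import Defs.
From HB Require Import structures.
From mathcomp Require Import all_boot all_order all_algebra all_fingroup.
From mathcomp Require Import complex.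
From mathcomp Require Import boolp classical_sets reals constructive_ereal ereal exp.
From mathcomp Require Import ring lra.
Import Order.TTheory GRing.Theory Num.Theory.
Local Open Scope ring_scope.
Set Implicit Arguments. Unset Strict Implicit. Unset Printing Implicit Defensive.

(** Let [omega] be the Choi state of [N] and [omega_B] its marginal on [R_B B].
    Since [D(omega || 1/a' (x) sigma) = - S(omega) + S(omega_B) + ln a'
    + D(omega_B || sigma)], feeding the maximally entangled state into [N] and
    [R (x) M] bounds the channel divergence from below for every [M], and the
    bound is the claimed value exactly when the Choi state of [M] is [omega_B],
    i.e. for [M0 Y = tr_A (N (1/a' (x) Y))].

    For [M0] no input does better.  An input [rho = \sum_al psi_al psi_al^*] equals
    [d \sum_al (T_al (x) 1) Phi (T_al (x) 1)^*]; averaging over the one-design makes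
    the operators [T_al U_g^T] Kraus operators of a channel on the reference, and by
    covariance [U_g^T] on the reference acts on Choi states as [V_g] on the output.
    So the bound is an instance of the data processing inequality.

    The latter is proved without integrals.  In the eigenbases of [rho] and [sigma],
    the relative entropy is a sum of terms [p (ln p - ln q)], each a limit of Riemann
    sums of [(1/u) (p^2 / ((1 - u) p + u q) - p)] over [u] in [(0, 1)].  For fixed [u],
    the sum of the [p^2 / ((1 - u) p + u q)] is the maximum over [X] of
    [2 Re tr (X^* rho) - u tr (X^* sigma X) - (1 - u) tr (X rho X^* )], and pulling [X]
    back along the channel can only increase this form, by the Schwarz inequality. *)

(** * Adjoints, Gram matrices and polarization *)

Section Adjoint.
Variable R : realType.
Local Notation C := (R[i]).

Lemma adjmxE m n (A : 'M[C]_(m, n)) i j : adjmx A i j = conjc (A j i).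
Proof. by rewrite !mxE. Qed.

Lemma adjmxK m n (A : 'M[C]_(m, n)) : adjmx (adjmx A) = A.
Proof. by apply/matrixP => i j; rewrite !adjmxE conjcK. Qed.

Lemma adjmxM m n p (A : 'M[C]_(m, n)) (B : 'M[C]_(n, p)) :
  adjmx (A *m B) = adjmx B *m adjmx A.
Proof. by rewrite /adjmx map_mxM trmx_mul. Qed.

Lemma adjmxD m n (A B : 'M[C]_(m, n)) : adjmx (A + B) = adjmx A + adjmx B.
Proof. by rewrite /adjmx map_mxD raddfD. Qed.

Lemma adjmxB m n (A B : 'M[C]_(m, n)) : adjmx (A - B) = adjmx A - adjmx B.
Proof. by rewrite /adjmx map_mxB raddfB. Qed.

Lemma adjmxZ m n c (A : 'M[C]_(m, n)) : adjmx (c *: A) = conjc c *: adjmx A.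
Proof. by rewrite /adjmx map_mxZ linearZ. Qed.

Lemma adjmx0 m n : adjmx (0 : 'M[C]_(m, n)) = 0.
Proof. by rewrite /adjmx map_mx0 trmx0. Qed.

Lemma adjmx1 n : adjmx (1%:M : 'M[C]_n) = 1%:M.
Proof. by rewrite /adjmx map_mx1 trmx1. Qed.

Lemma adjmx_sum m n (I : finType) (F : I -> 'M[C]_(m, n)) :
  adjmx (\sum_i F i) = \sum_i adjmx (F i).
Proof. exact: (big_morph _ (@adjmxD m n) (@adjmx0 m n)). Qed.

Lemma adjmx_delta m n (i : 'I_m) (j : 'I_n) :
  adjmx (delta_mx i j : 'M[C]_(m, n)) = delta_mx j i.
Proof. by rewrite /adjmx map_delta_mx trmx_delta. Qed.

Lemma adjmx_diag n (d : 'rV[R]_n) (f : R -> R) :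
  adjmx (diag_mx (map_mx (fun x => ((f x)%:C)%C) d)) =
  diag_mx (map_mx (fun x => ((f x)%:C)%C) d).
Proof.
apply/matrixP => i j; rewrite adjmxE !mxE eq_sym.
by have [->|_] := eqVneq i j; rewrite ?mulr1n ?mulr0n ?conjc_real ?conjc0.
Qed.

Lemma mxtrace_adj n (A : 'M[C]_n) : \tr (adjmx A) = conjc (\tr A).
Proof. by rewrite /adjmx mxtrace_tr -trace_map_mx. Qed.


Lemma normc_sqr (x : C) : x * conjc x = ((complex.Re x) ^+ 2 + (complex.Im x) ^+ 2)%:C%C.
Proof.
case: x => x y; apply/eqP; rewrite eq_complex /=.
by apply/andP; split; apply/eqP; ring.
Qed.

Lemma trace_gram_ge0 m n (A : 'M[C]_(m, n)) : 0 <= \tr (A *m adjmx A).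
Proof.
rewrite /mxtrace sumr_ge0 // => i _; rewrite mxE sumr_ge0 // => j _.
by rewrite adjmxE mulcJ_ge0.
Qed.

Lemma trace_gram_eq0 m n (A : 'M[C]_(m, n)) : \tr (A *m adjmx A) = 0 -> A = 0.
Proof.
have ge0 i j : 0 <= A i j * adjmx A j i by rewrite adjmxE mulcJ_ge0.
move/eqP; rewrite psumr_eq0 => [/allP H|i _]; last by rewrite mxE sumr_ge0.
apply/matrixP => i j; have := H i (mem_index_enum _); rewrite mxE psumr_eq0 //=.
move=> /allP /(_ j (mem_index_enum _)) /=.
by rewrite adjmxE mulf_eq0 conjc_eq0 orbb mxE => /eqP.
Qed.

Lemma unitarymxC n (U : 'M[C]_n) : Defs.unitarymx U -> adjmx U *m U = 1%:M.
Proof. exact: mulmx1C. Qed.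

(* Polarization: $x y^*$ is a combination of the $v v^*$ with $v = x + y, x + i y$. *)
Lemma linear_rank1_eq0 n p (D : 'M[C]_n -> 'M[C]_p) : linear D ->
  (forall v : 'cV[C]_n, D (v *m adjmx v) = 0) -> forall X, D X = 0.
Proof.
move=> linD D0.
have DD X Y : D (X + Y) = D X + D Y by have := linD 1 X Y; rewrite !scale1r.
have D00 : D 0 = 0 by have := linD 1 0 0; rewrite !scale1r !addr0 -[X in X = _]addr0 => /addrI.
have DZ c X : D (c *: X) = c *: D X by have := linD c X 0; rewrite D00 !addr0.
have Dxy (x y : 'cV[C]_n) : D (x *m adjmx y) = 0.
  have e1 : D (x *m adjmx y) + D (y *m adjmx x) = 0.
    have := D0 (x + y); rewrite adjmxD mulmxDl !mulmxDr !DD !D0.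
    by rewrite add0r addr0.
  have e2 : 'i%C *: D (y *m adjmx x) - 'i%C *: D (x *m adjmx y) = 0.
    have := D0 (x + 'i%C *: y); rewrite adjmxD adjmxZ mulmxDl !mulmxDr.
    rewrite -!scalemxAl -!scalemxAr !DD !DZ !D0 !scaler0 addr0 add0r addrC.
    suff -> : conjc 'i%C = - 'i%C :> C by rewrite scaleNr.
    by apply/eqP; rewrite eq_complex /= oppr0 !eqxx.
  have e3 : 2%:R *: D (x *m adjmx y) = 0.
    have ni : 'i%C != 0 :> C by rewrite eq_complex /= eqxx oner_eq0.
    move/eqP: e2; rewrite -scalerBr scaler_eq0 (negPf ni) subr_eq0 => /eqP e2.
    by rewrite scaler_nat mulr2n -{2}e2.
  by move/eqP: e3; rewrite scaler_eq0 pnatr_eq0 => /eqP.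
move=> X; rewrite (matrix_sum_delta X).
have Dsum (I : finType) (F : I -> 'M[C]_n) : D (\sum_i F i) = \sum_i D (F i).
  exact: (big_morph _ DD D00).
rewrite Dsum big1 // => i _; rewrite Dsum big1 // => j _; rewrite DZ.
have -> : delta_mx i j = (delta_mx i 0 : 'cV[C]_n) *m adjmx (delta_mx j 0 : 'cV[C]_n).
  by rewrite adjmx_delta mul_delta_mx.
by rewrite Dxy scaler0.
Qed.

End Adjoint.

(** * Positive semidefinite matrices, spectral decomposition and functional calculus *)

Section Positive.
Variable R : realType.
Local Notation C := (R[i]).
Local Notation rdiag d := (diag_mx (map_mx (fun x => (x%:C)%C) d)).

Lemma quad_trace n (A : 'M[C]_n) (v : 'cV[C]_n) :
  (adjmx v *m A *m v) 0 0 = \tr (A *m (v *m adjmx v)).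
Proof. by rewrite mulmxA mxtrace_mulC mulmxA trace_mx11. Qed.

(** The order on complex numbers makes the quadratic form of [A] real, so [adjmx A - A] has zero
    quadratic form. Polarization then kills [\tr (B *m X)] for every [X], in particular for matrix
    units. The trace is wrapped in a 1 by 1 matrix to fit [linear_rank1_eq0]. *)
Lemma psdmx_adj n (A : 'M[C]_n) : psdmx A -> adjmx A = A.
Proof.
move=> psdA; apply/eqP; rewrite -subr_eq0; apply/eqP.
set B := adjmx A - A.
pose D (X : 'M[C]_n) : 'M[C]_1 := (\tr (B *m X))%:M.
have linD : linear D.
  move=> c X Y; rewrite /D mulmxDr -scalemxAr linearD /= linearZ /=.
  by rewrite raddfD /= scale_scalar_mx.
have D0 (v : 'cV[C]_n) : D (v *m adjmx v) = 0.
  rewrite /D -quad_trace /B mulmxBr mulmxBl.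
  have q_real : conjc ((adjmx v *m A *m v) 0 0) = (adjmx v *m A *m v) 0 0.
    by rewrite -(RRe_real (ger0_real (psdA v))) conjc_real.
  rewrite !mxE -[X in X - _](_ : conjc ((adjmx v *m A *m v) 0 0) = _); last first.
    by rewrite -adjmxE !adjmxM adjmxK mulmxA !mxE.
  by rewrite q_real mxE subrr raddf0.
apply/matrixP => i j; rewrite [RHS]mxE.
have := linear_rank1_eq0 linD D0 (delta_mx j i); rewrite /D => /matrixP /(_ 0 0).
rewrite [LHS]mxE [RHS]mxE mulr1n => <-.
rewrite -(mul_delta_mx (0 : 'I_1)) mulmxA mxtrace_mulC mulmxA trace_mx11.
by rewrite -rowE -colE !mxE.
Qed.

(** Writing each eigenvalue as a value of the quadratic form makes it nonnegative in every
    decomposition of a positive [A], not just in a chosen one. *)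
Lemma eigdec_diag n (A : 'M[C]_n) p : eigdec A p ->
  forall i, ((p.2 0 i)%:C)%C = (adjmx (col i p.1) *m A *m col i p.1) 0 0.
Proof.
move=> [uU ->] i.
have e : adjmx p.1 *m col i p.1 = delta_mx i 0.
  by rewrite colE mulmxA unitarymxC // mul1mx.
have e' : adjmx (col i p.1) *m p.1 = delta_mx 0 i.
  by rewrite -[p.1 in X in _ *m X]adjmxK -adjmxM e adjmx_delta.
by rewrite !mulmxA e' -mulmxA e -rowE -colE !mxE eqxx mulr1n.
Qed.

Lemma psdmx_spectral n (A : 'M[C]_n) : psdmx A ->
  exists2 p, eigdec A p & forall i, 0 <= p.2 0 i.
Proof.
move=> psdA; have hA := psdmx_adj psdA.
have hermA : A \is hermsymmx.
  by apply/is_hermitianmxP; rewrite expr0 scale1r -{1}hA /adjmx map_trmx.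
have [S [d [uS eA dreal]]] : exists (S : 'M[C]_n) (d : 'rV[C]_n),
    [/\ adjmx S *m S = 1%:M, A = adjmx S *m diag_mx d *m S &
        forall i, d 0 i \is Num.real].
  have adjS : map_mx Num.conj_op (spectralmx A)^T = adjmx (spectralmx A).
    by rewrite /adjmx map_trmx.
  exists (spectralmx A), (spectral_diag A); split.
  - by apply: mulmx1C; rewrite -adjS; apply/unitarymxP/spectral_unitarymx.
  - by rewrite -adjS -(invmx_unitary (spectral_unitarymx A));
      apply/orthomx_spectralP/hermitian_normalmx.
  - by move=> i; have /mxOverP := hermitian_spectral_diag_real hermA.
pose p := (adjmx S, map_mx (@complex.Re R) d).
have ep : eigdec A p.
  split; rewrite /Defs.unitarymx /= adjmxK //.
  have -> : map_mx (fun x => (x%:C)%C) (map_mx (@complex.Re R) d) = d.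
    by apply/rowP => i; rewrite !mxE RRe_real.
  exact: eA.
by exists p => // i; rewrite -ler0c (eigdec_diag ep) psdA.
Qed.

Lemma eigdec_eig_ge0 n (A : 'M[C]_n) p : psdmx A -> eigdec A p ->
  forall i, 0 <= p.2 0 i.
Proof. by move=> psdA ep i; rewrite -ler0c (eigdec_diag ep) psdA. Qed.

Lemma psdmx_gram m n (B : 'M[C]_(m, n)) : psdmx (B *m adjmx B).
Proof.
move=> v; rewrite mulmxA -mulmxA -trace_mx11.
have -> : adjmx B *m v = adjmx (adjmx v *m B) by rewrite adjmxM adjmxK.
exact: trace_gram_ge0.
Qed.

Lemma psdmx_gramP n (A : 'M[C]_n) : psdmx A -> exists B : 'M[C]_n, A = B *m adjmx B.
Proof.
move=> /psdmx_spectral[[U d] [uU ->] /= d_ge0].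
exists (U *m diag_mx (map_mx (fun x => ((Num.sqrt x)%:C)%C) d)).
rewrite adjmxM (adjmx_diag d (@Num.sqrt R)) !mulmxA; congr (_ *m _).
rewrite -!mulmxA; congr (_ *m _).
rewrite mulmx_diag; congr diag_mx; apply/rowP => i.
by rewrite !mxE -rmorphM /= -expr2 sqr_sqrtr.
Qed.

Lemma psdmx_conj m n (A : 'M[C]_n) (K : 'M[C]_(m, n)) : psdmx A ->
  psdmx (K *m A *m adjmx K).
Proof.
move=> /psdmx_gramP[B ->]; rewrite mulmxA -[_ *m _ *m adjmx K]mulmxA -adjmxM.
exact: psdmx_gram.
Qed.

Lemma psdmx_sum n (I : finType) (F : I -> 'M[C]_n) :
  (forall i, psdmx (F i)) -> psdmx (\sum_i F i).
Proof.
move=> psdF v; rewrite mulmx_sumr mulmx_suml summxE sumr_ge0 // => i _.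
exact: psdF.
Qed.

Lemma psdmxZ n (c : C) (A : 'M[C]_n) : 0 <= c -> psdmx A -> psdmx (c *: A).
Proof.
by move=> c0 psdA v; rewrite -scalemxAr -scalemxAl mxE mulr_ge0.
Qed.

(** With [A = S *m adjmx S], the trace is the squared Hilbert-Schmidt norm of [adjmx B *m S]. *)
Lemma psdmx_ker n p (A : 'M[C]_n) (B : 'M[C]_(n, p)) : psdmx A ->
  \tr (adjmx B *m A *m B) = 0 -> A *m B = 0.
Proof.
move=> /psdmx_gramP[S ->]; rewrite mulmxA -[X in \tr X]mulmxA.
have e : adjmx S *m B = adjmx (adjmx B *m S) by rewrite adjmxM adjmxK.
rewrite e => /trace_gram_eq0 z.
by rewrite -mulmxA e z adjmx0 mulmx0.
Qed.

Lemma trace_psd_gram_ge0 m n (A : 'M[C]_n) (X : 'M[C]_(m, n)) : psdmx A ->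
  0 <= \tr (X *m A *m adjmx X).
Proof.
move=> /psdmx_gramP[B ->]; rewrite mulmxA -[_ *m _ *m adjmx X]mulmxA -adjmxM.
exact: trace_gram_ge0.
Qed.

(** The choice made by [xget] does not matter. For two decompositions of [A], the matrix
    [W = adjmx V *m U] intertwines the two diagonals, so [W i j] is nonzero only between equal
    eigenvalues; hence it also intertwines their images under [f]. *)
Lemma mxfun_eigdec (f : R -> R) n (A : 'M[C]_n) p : eigdec A p ->
  mxfun f A = p.1 *m diag_mx (map_mx (fun x => ((f x)%:C)%C) p.2) *m adjmx p.1.
Proof.
move=> ep; rewrite /mxfun.
case: xgetP => [q _ eq|/(_ p)//].
case: p q ep eq => [U d] [V e] /= [/= uU eA] [/= uV eA'].
have comm : rdiag e *m (adjmx V *m U) = (adjmx V *m U) *m rdiag d.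
  transitivity (adjmx V *m A *m U).
    by rewrite {1}eA' !mulmxA (unitarymxC uV) mul1mx.
  by rewrite {1}eA -!mulmxA (unitarymxC uU) mulmx1.
have commf : diag_mx (map_mx (fun x => ((f x)%:C)%C) e) *m (adjmx V *m U) =
    (adjmx V *m U) *m diag_mx (map_mx (fun x => ((f x)%:C)%C) d).
  move: comm; set W := adjmx V *m U => comm.
  have dl g i j : (diag_mx (map_mx g e) *m W) i j = g (e 0 i) * W i j :> C.
    by rewrite mul_diag_mx mxE; congr (_ * _); rewrite mxE.
  have dr g i j : (W *m diag_mx (map_mx g d)) i j = W i j * g (d 0 j) :> C.
    by rewrite mul_mx_diag mxE; congr (_ * _); rewrite mxE.
  apply/matrixP => i j; move/matrixP/(_ i j): comm.
  rewrite dl dr => weq; rewrite dl dr.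
  have [w0|w0] := eqVneq (W i j) 0; first by rewrite w0 mulr0 mul0r.
  by move: weq; rewrite [RHS]mulrC => /(mulIf w0) /complexI ->; rewrite mulrC.
rewrite -[LHS]mulmx1 -uU -!mulmxA [adjmx V *m _]mulmxA.
rewrite [diag_mx _ *m (adjmx V *m U *m _)]mulmxA commf !mulmxA uV mul1mx.
by rewrite -!mulmxA.
Qed.

(** [P] is typed as rectangular, although [m = n] follows, because the permutation behind [mid_swap]
    links dimensions that are equal but not convertible. *)
Lemma mxfun_conj m n (A : 'M[C]_n) (P : 'M[C]_(m, n)) :
  P *m adjmx P = 1%:M -> adjmx P *m P = 1%:M -> psdmx A ->
  forall f, mxfun f (P *m A *m adjmx P) = P *m mxfun f A *m adjmx P.
Proof.
move=> PP1 PP2 psdA f.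
have emn : m = n.
  by apply/eqP; rewrite eqn_leq (mulmx1_min PP1) (mulmx1_min PP2).
subst m; have [[U d] ep _] := psdmx_spectral psdA.
rewrite (mxfun_eigdec f ep).
have ep' : eigdec (P *m A *m adjmx P) (P *m U, d).
  case: ep => uU eA; split => /=.
    by rewrite /Defs.unitarymx adjmxM mulmxA -(mulmxA P) uU mulmx1.
  by rewrite eA /= adjmxM !mulmxA.
by rewrite (mxfun_eigdec f ep') /= adjmxM !mulmxA.
Qed.

End Positive.

(** * Riemann sums for the logarithm and the scalar terms of the relative entropy *)

Section LogApproximation.
Variable R : realType.
Implicit Types (x p q : R) (n : nat).

Lemma ln_le_sub1 x : 0 < x -> ln x <= x - 1.
Proof.
by move=> x0; rewrite -[in X in X <= _](subrK 1 x) addrC le_ln1Dx // ltrBrDl subrr.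
Qed.

(* Left Riemann sums of [ln x = \int_0^1 (x - 1) / (1 + u (x - 1)) du], compared
   with the integral by telescoping [ln y <= y - 1]. *)
Lemma ln_riemann_sum x n : 0 < x ->
  ln x <= \sum_(k < n.+1) (x - 1) / n.+1%:R / (1 + k%:R / n.+1%:R * (x - 1))
       <= ln x + (x - 1) ^+ 2 / x / n.+1%:R.
Proof.
move=> x0; set d := (x - 1) / n.+1%:R; pose s k := 1 + k%:R / n.+1%:R * (x - 1).
have n0 : 0 < n.+1%:R :> R by rewrite ltr0n.
have sE k : s k.+1 = s k + d by rewrite /s /d -natr1; field; rewrite lt0r_neq0.
have s0 k : (k <= n.+1)%N -> 0 < s k.
  move=> kn; have -> : s k = (1 - k%:R / n.+1%:R) + k%:R / n.+1%:R * x.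
    by rewrite /s; ring.
  have u0 : 0 <= k%:R / n.+1%:R :> R by rewrite divr_ge0 // ltW.
  have u1 : k%:R / n.+1%:R <= 1 :> R by rewrite ler_pdivrMr // mul1r ler_nat.
  move: u1; rewrite le_eqVlt => /orP[/eqP ->|u1]; first by rewrite subrr add0r mul1r.
  by rewrite ltr_pwDl ?subr_gt0 // mulr_ge0 // ltW.
have step k : (k < n.+1)%N -> d / s k.+1 <= ln (s k.+1) - ln (s k) <= d / s k.
  move=> kn; have a0 := s0 _ (ltnW kn); have b0 := s0 _ kn.
  apply/andP; split.
    rewrite -opprB -ln_div ?posrE // lerNr.
    have -> : - (d / s k.+1) = s k / s k.+1 - 1.
      by rewrite sE; field; rewrite -sE lt0r_neq0.
    by rewrite ln_le_sub1 // divr_gt0.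
  rewrite -ln_div ?posrE //.
  have -> : d / s k = s k.+1 / s k - 1 by rewrite sE; field; rewrite lt0r_neq0.
  by rewrite ln_le_sub1 // divr_gt0.
(* By [step], the sum exceeds [ln (s K)] by at most the telescoping sum of the
   [d / s k - d / s k.+1]. *)
have main K : (K <= n.+1)%N ->
    ln (s K) <= \sum_(k < K) d / s k <= ln (s K) + d * (1 - (s K)^-1).
  elim: K => [_|K IH KS].
    by rewrite big_ord0 /s !mul0r addr0 ln1 invr1 subrr mulr0 addr0 lexx.
  rewrite big_ord_recr /=; have := IH (ltnW KS); have := step _ KS.
  by move=> /andP[? ?] /andP[? ?]; apply/andP; split; lra.
have sn : s n.+1 = x by rewrite /s divff ?lt0r_neq0 // mul1r addrC subrK.
have := main _ (leqnn _); rewrite sn => /andP[-> /le_trans -> //=].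
rewrite lerD2l; suff -> : d * (1 - x^-1) = (x - 1) ^+ 2 / x / n.+1%:R by [].
by rewrite /d; field; rewrite !lt0r_neq0.
Qed.

Definition relent_term p q : R := p * (logsupp p - logsupp q).

Definition quad_term (u : R) p q : R := p ^+ 2 / ((1 - u) * p + u * q).

(** Riemann sum at the nodes [u = k.+1 / n.+1]: the factor [1 / u] of the integrand times the step
    [1 / n.+1] is [1 / k.+1]. The nodes stay strictly between 0 and 1. *)
Definition relent_approx n p q : R :=
  \sum_(k < n) (k.+1%:R)^-1 * (quad_term (k.+1%:R / n.+1%:R) p q - p).

(** With [x = q / p], the integrand [(1/u) (p^2 / ((1 - u) p + u q) - p)] equals
    [- p (x - 1) / (1 + u (x - 1))], so this is [ln_riemann_sum] multiplied by [- p]. *)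
Lemma relent_termP n p q : 0 <= p -> 0 <= q -> (q = 0 -> p = 0) ->
  `|relent_term p q - relent_approx n p q| <=
    (`|q - p| + (q - p) ^+ 2 / q) / n.+1%:R.
Proof.
have n0 : 0 < n.+1%:R :> R by rewrite ltr0n.
rewrite le_eqVlt => /orP[/eqP <- q0 _|p0].
  rewrite /relent_term mul0r /relent_approx big1 ?subrr ?normr0 => [|k _]; last first.
    by rewrite /quad_term expr0n mul0r subrr mulr0.
  by rewrite divr_ge0 ?addr_ge0 ?divr_ge0 ?sqr_ge0 // ltW.
rewrite le_eqVlt => /orP[/eqP <- /(_ erefl) p00|q0 _]; first by rewrite p00 ltxx in p0.
have x0 : 0 < q / p by rewrite divr_gt0.
(* The node [u = 0] is split off: it is absent from [relent_approx], and its term [(x - 1) / n.+1]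
   accounts for [|q - p|] in the error. *)
have := ln_riemann_sum n x0; set x := q / p; rewrite /= big_ord_recl /=.
rewrite mul0r mul0r addr0 divr1.
set S := \sum_(i < n) _ => /andP[lo hi].
have -> : relent_approx n p q = - (p * S).
  rewrite /relent_approx /S mulr_sumr -sumrN; apply: eq_bigr => k _.
  rewrite /quad_term /bump /= add1n.
  set u := k.+1%:R / n.+1%:R.
  have ? : 0 < u by rewrite divr_gt0 // ltr0n.
  have ? : u < 1 by rewrite ltr_pdivrMr // mul1r ltr_nat ltnS ltn_ord.
  have -> : (k.+1%:R)^-1 = (u * n.+1%:R)^-1 :> R by rewrite /u divfK ?lt0r_neq0.
  have m0 : 0 < (1 - u) * p + u * q by rewrite addr_gt0 // mulr_gt0 // subr_gt0.
  have m1 : 0 < p + u * (q - p) by lra.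
  by rewrite /x; field; rewrite mulN1r nat1r !lt0r_neq0.
rewrite /relent_term /logsupp p0 q0.
have -> : ln p - ln q = - ln x by rewrite /x ln_div ?posrE // opprB.
have -> : p * - ln x - - (p * S) = p * (S - ln x) by ring.
rewrite normrM gtr0_norm //.
have -> : (`|q - p| + (q - p) ^+ 2 / q) / n.+1%:R =
   p * ((`|x - 1| + (x - 1) ^+ 2 / x) / n.+1%:R).
  have -> : `|q - p| = p * `|x - 1|.
    by rewrite -{2}(gtr0_norm p0) -normrM /x; congr (`|_|); field; rewrite lt0r_neq0.
  by rewrite /x; field; rewrite !lt0r_neq0.
rewrite ler_pM2l // ler_norml.
have := ler_norm (x - 1); have := ler_norm (1 - x); rewrite distrC => h1 h2.
have g1 : - `|x - 1| / n.+1%:R <= (x - 1) / n.+1%:R by rewrite ler_pM2r ?invr_gt0 //; lra.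
have g2 : (x - 1) / n.+1%:R <= `|x - 1| / n.+1%:R by rewrite ler_pM2r ?invr_gt0 //.
have g3 : 0 <= (x - 1) ^+ 2 / x / n.+1%:R by rewrite !divr_ge0 ?sqr_ge0 // ltW.
move: g1 g2 g3 lo hi; rewrite [(_ + _ / x) / _]mulrDl mulNr.
move: (`|x - 1| / _) (_ ^+ 2 / x / _) ((x - 1) / _) => A B D *.
by apply/andP; split; lra.
Qed.

(** This is [ln x <= x - 1] at [x = q / p], the scalar form of Klein's inequality. *)
Lemma relent_term_ge p q : 0 <= p -> 0 <= q -> (q = 0 -> p = 0) ->
  p - q <= relent_term p q.
Proof.
rewrite /relent_term le_eqVlt => /orP[/eqP <- q0 _|p0]; first by lra.
rewrite le_eqVlt => /orP[/eqP <- /(_ erefl) p00|q0 _]; first by rewrite p00 ltxx in p0.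
rewrite /logsupp p0 q0 -ler_pdivrMl //.
have := @ln_le_sub1 (q / p); rewrite divr_gt0 // => /(_ isT).
rewrite ln_div ?posrE //.
have -> : p^-1 * (p - q) = 1 - q / p by field; rewrite lt0r_neq0.
lra.
Qed.

Lemma ler_archi_inv (x y c : R) : (forall n, x <= y + c / n.+1%:R) -> x <= y.
Proof.
move=> h; apply/ler_addgt0Pr => e e0.
have [c0|c0] := leP c 0.
  by apply: le_trans (h 0%N) _; rewrite divr1; lra.
have ce : 0 <= c / e by rewrite divr_ge0 // ltW.
have := archi_boundP ce; set n := Num.bound _ => hn.
apply: le_trans (h n) _; rewrite lerD2l ler_pdivrMr ?ltr0n //.
move: hn; rewrite ltr_pdivrMr // -natr1 => hn; nra.
Qed.

End LogApproximation.

(** * Relative entropy in a pair of eigenbases *)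

Section RelativeEntropy.
Variable R : realType.
Local Notation C := (R[i]).
Local Notation fdiag f d := (diag_mx (map_mx (fun x => ((f x)%:C)%C) d)).

Definition normsq (z : C) : R := complex.Re z ^+ 2 + complex.Im z ^+ 2.

Lemma normsq_ge0 z : 0 <= normsq z.
Proof. by rewrite addr_ge0 ?sqr_ge0. Qed.

Lemma mulJc (z : C) : conjc z * z = ((normsq z)%:C)%C.
Proof. by rewrite mulrC normc_sqr. Qed.

(** For eigenbases [u_i] of [rho] and [v_j] of [sigma] these are the weights [|<v_j, u_i>|^2] of the
    Nussbaum-Szkola distributions, which reduce traces to scalar double sums. *)
Definition overlap n (U V : 'M[C]_n) i j : R := normsq ((adjmx V *m U) j i).

Definition overlap_sum n (r s : 'M[C]_n * 'rV[R]_n) (F : R -> R -> R) : R :=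
  \sum_i \sum_j overlap r.1 s.1 i j * F (r.2 0 i) (s.2 0 j).

Lemma overlap_sumB n (r s : 'M[C]_n * 'rV[R]_n) F G :
  overlap_sum r s F - overlap_sum r s G = overlap_sum r s (fun x y => F x y - G x y).
Proof.
rewrite /overlap_sum -sumrB; apply: eq_bigr => i _.
by rewrite -sumrB; apply: eq_bigr => j _; rewrite mulrBr.
Qed.

Lemma overlap_sum_le n (r s : 'M[C]_n * 'rV[R]_n) F G :
  (forall i j, overlap r.1 s.1 i j != 0 ->
    F (r.2 0 i) (s.2 0 j) <= G (r.2 0 i) (s.2 0 j)) ->
  overlap_sum r s F <= overlap_sum r s G.
Proof.
move=> FG; apply: ler_sum => i _; apply: ler_sum => j _.
have [->|o0] := eqVneq (overlap r.1 s.1 i j) 0; first by rewrite !mul0r.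
by rewrite ler_wpM2l ?normsq_ge0 // FG.
Qed.

Lemma trace_diag_gram n m (W : 'M[C]_(n, m)) (g : 'rV[C]_n) (f : 'rV[C]_m) :
  \tr (adjmx W *m diag_mx g *m (W *m diag_mx f)) =
  \sum_i \sum_j g 0 j * f 0 i * ((normsq (W j i))%:C)%C.
Proof.
apply: eq_bigr => i _; rewrite mxE; apply: eq_bigr => j _.
by rewrite !mul_mx_diag mxE [in X in _ * X = _]mxE adjmxE -mulJc; ring.
Qed.

Lemma trace_mxdec_overlap n (U V : 'M[C]_n) (d e : 'rV[R]_n) (f g : R -> R) :
  \tr (U *m fdiag f d *m adjmx U *m (V *m fdiag g e *m adjmx V)) =
  ((overlap_sum (U, d) (V, e) (fun x y => f x * g y))%:C)%C.
Proof.
rewrite mulmxA mxtrace_mulC.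
have -> : adjmx V *m (U *m fdiag f d *m adjmx U *m (V *m fdiag g e)) =
   (adjmx V *m U) *m fdiag f d *m (adjmx (adjmx V *m U) *m fdiag g e).
  by rewrite adjmxM adjmxK !mulmxA.
rewrite mxtrace_mulC trace_diag_gram rmorph_sum; apply: eq_bigr => i _.
rewrite rmorph_sum; apply: eq_bigr => j _.
by rewrite /= /overlap [X in X * _ * _]mxE [X in _ * X * _]mxE !rmorphM /=; ring.
Qed.

Lemma trace_mxfun_overlap n (A : 'M[C]_n) r s (f : R -> R) : eigdec A r ->
  Defs.unitarymx s.1 ->
  \tr (mxfun f A) = ((overlap_sum r s (fun x _ => f x))%:C)%C.
Proof.
move=> er us; rewrite (mxfun_eigdec f er) -[X in \tr X]mulmx1 -us.
have := trace_mxdec_overlap r.1 s.1 r.2 s.2 f (fun=> 1).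
have -> : fdiag (fun=> 1) s.2 = 1%:M :> 'M[C]_n.
  by apply/matrixP => i j; rewrite !mxE.
rewrite mulmx1 => ->; congr (_%:C)%C; case: r s {er us} => [U d] [V e].
by apply: eq_bigr => i _; apply: eq_bigr => j _; rewrite mulr1.
Qed.

Lemma mxfun_id n (A : 'M[C]_n) : psdmx A -> mxfun id A = A.
Proof. by move=> /psdmx_spectral[r er _]; rewrite (mxfun_eigdec _ er) -(er.2). Qed.

Lemma mul_mxfun n (A : 'M[C]_n) f : psdmx A ->
  A *m mxfun f A = mxfun (fun x => x * f x) A.
Proof.
move=> /psdmx_spectral[r er _]; rewrite !(mxfun_eigdec _ er) {1}(er.2) !mulmxA.
congr (_ *m _); rewrite -!mulmxA; congr (_ *m _).
rewrite (mulmxA (adjmx r.1)) (unitarymxC er.1) mul1mx mulmx_diag.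
by congr diag_mx; apply/rowP => i; rewrite !mxE rmorphM.
Qed.

Lemma trace_overlap n (A : 'M[C]_n) r s : psdmx A -> eigdec A r ->
  Defs.unitarymx s.1 -> complex.Re (\tr A) = overlap_sum r s (fun x _ => x).
Proof.
by move=> pA er us; rewrite -{1}(mxfun_id pA) (trace_mxfun_overlap _ er us).
Qed.

Lemma overlapC n (U V : 'M[C]_n) i j : overlap U V i j = overlap V U j i.
Proof.
rewrite /overlap.
have -> : (adjmx V *m U) j i = conjc ((adjmx U *m V) i j).
  by rewrite -adjmxE adjmxM adjmxK.
by case: ((adjmx U *m V) i j) => x y; rewrite /normsq /= sqrrN.
Qed.

Lemma trace_overlapr n (A : 'M[C]_n) r s : psdmx A -> eigdec A s ->
  Defs.unitarymx r.1 -> complex.Re (\tr A) = overlap_sum r s (fun _ y => y).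
Proof.
move=> pA es ur; rewrite (trace_overlap pA es ur) /overlap_sum exchange_big.
by apply: eq_bigr => i _; apply: eq_bigr => j _; rewrite overlapC.
Qed.

Lemma relent_overlap n (rho sigma : 'M[C]_n) r s : psdmx rho ->
  eigdec rho r -> eigdec sigma s ->
  complex.Re (\tr (rho *m (mxlog rho - mxlog sigma))) =
  overlap_sum r s (@relent_term R).
Proof.
move=> prho er es; rewrite mulmxBr linearB /= mul_mxfun //.
rewrite (trace_mxfun_overlap _ er (es.1)) -{1}(mxfun_id prho).
rewrite /mxlog !(mxfun_eigdec _ er, mxfun_eigdec _ es) trace_mxdec_overlap /=.
rewrite -!surjective_pairing.
rewrite overlap_sumB; apply: eq_bigr => i _; apply: eq_bigr => j _.
by rewrite /relent_term -mulrBr.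
Qed.

(** An eigenvector [v_j] of [sigma] with eigenvalue 0 is annihilated by [rho]; its component along
    [u_i] gives [p_i <u_i, v_j> = 0]. The scalar lemmas thus apply wherever the weight is
    nonzero. *)
Lemma supp_le_overlap n (rho sigma : 'M[C]_n) r s : supp_le rho sigma ->
  eigdec rho r -> eigdec sigma s ->
  forall i j, overlap r.1 s.1 i j != 0 -> s.2 0 j = 0 -> r.2 0 i = 0.
Proof.
move=> supp er es i j o0 sj0.
have sv : sigma *m col j s.1 = 0.
  rewrite es.2 colE -!mulmxA (mulmxA (adjmx s.1)) (unitarymxC es.1) mul1mx -colE.
  suff -> : col j (diag_mx (map_mx (fun x => (x%:C)%C) s.2)) = 0 :> 'cV[C]_n by rewrite mulmx0.
  apply/colP => k; rewrite !mxE; have [->|_] := eqVneq k j; last by rewrite mulr0n.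
  by rewrite sj0.
have := supp _ sv; rewrite er.2 => /(congr1 (mulmx (adjmx r.1))).
rewrite mulmx0 !mulmxA (unitarymxC er.1) mul1mx -mulmxA mul_diag_mx.
move=> /matrixP /(_ i 0); rewrite [LHS]mxE [RHS]mxE.
have -> : (adjmx r.1 *m col j s.1) i 0 = conjc ((adjmx s.1 *m r.1) j i).
  by rewrite -adjmxE adjmxM adjmxK colE mulmxA -colE mxE.
rewrite mxE => /eqP; rewrite mulf_eq0 conjc_eq0 => /orP[/eqP[] //|/eqP z].
by rewrite /overlap z /normsq /= expr0n /= addr0 eqxx in o0.
Qed.

(* The maximum over [X] of this quadratic form is the [overlap_sum] of
   [quad_term u], which makes the latter monotone under channels. *)
Definition qform (u : R) n (rho sigma X : 'M[C]_n) : R :=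
  2 * complex.Re (\tr (adjmx X *m rho))
  - u * complex.Re (\tr (adjmx X *m sigma *m X))
  - (1 - u) * complex.Re (\tr (X *m rho *m adjmx X)).

(** Writing [X] with columns in the basis of [sigma] and rows in that of [rho] decouples the form
    into one scalar quadratic per entry of [Y]. *)
Lemma qform_eig (u : R) n (rho sigma Y : 'M[C]_n) r s :
  eigdec rho r -> eigdec sigma s ->
  qform u rho sigma (s.1 *m Y *m adjmx r.1) =
  \sum_i \sum_j (2 * r.2 0 i * complex.Re (conjc (Y j i) * (adjmx s.1 *m r.1) j i)
     - ((1 - u) * r.2 0 i + u * s.2 0 j) * normsq (Y j i)).
Proof.
case: r s => [U d] [V e] [/= uU ->] [/= uV ->].
have uU' := unitarymxC uU; have uV' := unitarymxC uV.
set D := diag_mx (map_mx _ d); set E := diag_mx (map_mx _ e).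
have adjX : adjmx (V *m Y *m adjmx U) = U *m adjmx Y *m adjmx V.
  by rewrite !adjmxM adjmxK mulmxA.
have t1 : \tr (adjmx (V *m Y *m adjmx U) *m (U *m D *m adjmx U)) =
    \tr (adjmx Y *m (adjmx V *m U *m D)).
  by rewrite adjX -!mulmxA mxtrace_mulC -!mulmxA uU' mulmx1.
(* The identities [diag_mx (const_mx 1)] here and in [t3] give both traces the shape of
   [trace_diag_gram]. *)
have t2 : \tr (adjmx (V *m Y *m adjmx U) *m (V *m E *m adjmx V) *m (V *m Y *m adjmx U)) =
    \tr (adjmx Y *m E *m (Y *m diag_mx (const_mx 1))).
  rewrite adjX diag_const_mx mulmx1 !mulmxA mxtrace_mulC.
  rewrite -!mulmxA (mulmxA (adjmx V) V) uV' mul1mx (mulmxA (adjmx V) V) uV' mul1mx.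
  by rewrite (mulmxA (adjmx U) U) uU' mul1mx.
have t3 : \tr ((V *m Y *m adjmx U) *m (U *m D *m adjmx U) *m adjmx (V *m Y *m adjmx U)) =
    \tr (adjmx Y *m diag_mx (const_mx 1) *m (Y *m D)).
  rewrite adjX diag_const_mx mulmx1 !mulmxA mxtrace_mulC.
  rewrite -!mulmxA (mulmxA (adjmx U) U) uU' mul1mx (mulmxA (adjmx U) U) uU' mul1mx.
  by rewrite (mulmxA (adjmx V) V) uV' mul1mx mulmxA mxtrace_mulC.
rewrite /qform t1 t2 t3 !trace_diag_gram.
set W := adjmx V *m U.
have Re_sum (I : finType) (F : I -> C) : complex.Re (\sum_i F i) = \sum_i complex.Re (F i).
  by apply: (big_morph (@complex.Re R)) => // -[? ?] [? ?].
rewrite /mxtrace !Re_sum !mulr_sumr -!sumrB; apply: eq_bigr => i _.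
rewrite mxE !Re_sum !mulr_sumr -!sumrB; apply: eq_bigr => j _.
rewrite /W /D mul_mx_diag !mxE /=; set w := \sum_k _.
case: (Y j i) => y1 y2; case: w => w1 w2 /=; ring.
Qed.


(** Completing the square entrywise: with [m = (1 - u) p + u q], the gap is [|m y - p w|^2 / m]. *)
Lemma qform_le (u : R) n (rho sigma X : 'M[C]_n) r s : 0 < u < 1 ->
  psdmx rho -> psdmx sigma -> eigdec rho r -> eigdec sigma s ->
  qform u rho sigma X <= overlap_sum r s (quad_term u).
Proof.
move=> /andP[u0 u1] prho psig er es.
have -> : X = s.1 *m (adjmx s.1 *m X *m r.1) *m adjmx r.1.
  by rewrite !mulmxA es.1 mul1mx -mulmxA er.1 mulmx1.
rewrite (qform_eig _ _ er es); set Y := adjmx s.1 *m X *m r.1.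
apply: ler_sum => i _; apply: ler_sum => j _; rewrite /overlap /quad_term.
have p0 := eigdec_eig_ge0 prho er i; have q0 := eigdec_eig_ge0 psig es j.
move: (r.2 0 i) (s.2 0 j) p0 q0 => p q p0 q0.
have m_ge0 : 0 <= (1 - u) * p + u * q.
  by rewrite addr_ge0 // mulr_ge0 // ?subr_ge0 ltW.
case: (Y j i) => y1 y2; case: ((adjmx s.1 *m r.1) j i) => w1 w2; rewrite /normsq /=.
move: m_ge0; rewrite le_eqVlt => /orP[/eqP m0|m_gt0].
  (* If [m = 0] then [p = 0], and both sides vanish since the inverse of 0 is 0. *)
  have p00 : p = 0.
    apply/eqP; rewrite eq_le p0 andbT.
    have := mulr_ge0 (ltW u0) q0 => uq.
    by rewrite -(ler_pM2l (_ : 0 < 1 - u)) ?subr_gt0 // mulr0; lra.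
  by rewrite -m0 p00 invr0 !(mulr0, mul0r, subr0).
set m := (X in 0 < X) in m_gt0 *.
rewrite mulrA ler_pdivlMr //.
rewrite -subr_ge0 (_ : _ - _ = (m * y1 - p * w1) ^+ 2 + (m * y2 - p * w2) ^+ 2).
  by rewrite addr_ge0 ?sqr_ge0.
by rewrite /m; ring.
Qed.

Lemma qform_max (u : R) n (rho sigma : 'M[C]_n) r s : 0 < u < 1 ->
  psdmx rho -> psdmx sigma -> eigdec rho r -> eigdec sigma s ->
  exists X, qform u rho sigma X = overlap_sum r s (quad_term u).
Proof.
move=> /andP[u0 u1] prho psig er es.
(* The entries solve [m y = p w], the equality case of the completed square. *)
pose Y : 'M[C]_n := \matrix_(j, i)
  (((r.2 0 i / ((1 - u) * r.2 0 i + u * s.2 0 j))%:C)%C * (adjmx s.1 *m r.1) j i).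
exists (s.1 *m Y *m adjmx r.1); rewrite (qform_eig _ _ er es).
apply: eq_bigr => i _; apply: eq_bigr => j _; rewrite /overlap /quad_term.
have -> : Y j i = ((r.2 0 i / ((1 - u) * r.2 0 i + u * s.2 0 j))%:C)%C *
    (adjmx s.1 *m r.1) j i.
  by rewrite mxE.
have p0 := eigdec_eig_ge0 prho er i; have q0 := eigdec_eig_ge0 psig es j.
move: (r.2 0 i) (s.2 0 j) p0 q0 => p q p0 q0.
have [m0|m0] := eqVneq ((1 - u) * p + u * q) 0.
  by rewrite m0 invr0 !mulr0 mul0r mul0r conjc0 mul0r /= mulr0 subrr.
case: ((adjmx s.1 *m r.1) j i) => w1 w2; rewrite /normsq /=.
by field.
Qed.

Lemma trace_sesquiB m n (A B : 'M[C]_(m, n)) (S : 'M[C]_n) :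
  \tr ((A - B) *m S *m adjmx (A - B)) =
  \tr (A *m S *m adjmx A) - \tr (A *m S *m adjmx B) - \tr (B *m S *m adjmx A)
    + \tr (B *m S *m adjmx B).
Proof.
have trB (X Y : 'M[C]_m) : \tr (X - Y) = \tr X - \tr Y by rewrite linearB.
by rewrite adjmxB !mulmxBl !mulmxBr !trB opprB addrA addrAC.
Qed.

(* Expand [0 <= \sum_l tr ((Z_l K_l - K_l Y) S (Z_l K_l - K_l Y)^* )]. *)
Lemma kraus_schwarz m n (L : finType) (K : L -> 'M[C]_(m, n)) (Z : L -> 'M[C]_m)
    (S Y : 'M[C]_n) :
  \sum_l adjmx (K l) *m K l = 1%:M -> psdmx S ->
  Y = \sum_l adjmx (K l) *m Z l *m K l ->
  \tr (Y *m S *m adjmx Y) <=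
  \sum_l \tr (Z l *m (K l *m S *m adjmx (K l)) *m adjmx (Z l)).
Proof.
move=> K1 psdS eY; rewrite -subr_ge0.
have q_ge0 : 0 <= \sum_l \tr ((Z l *m K l - K l *m Y) *m S *m adjmx (Z l *m K l - K l *m Y)).
  by apply: sumr_ge0 => l _; apply: trace_psd_gram_ge0.
suff -> : \sum_l \tr (Z l *m (K l *m S *m adjmx (K l)) *m adjmx (Z l)) -
      \tr (Y *m S *m adjmx Y) =
    \sum_l \tr ((Z l *m K l - K l *m Y) *m S *m adjmx (Z l *m K l - K l *m Y)) by [].
have cross : \sum_l \tr (Z l *m K l *m S *m adjmx (K l *m Y)) = \tr (Y *m S *m adjmx Y).
  rewrite [X in \tr (X *m _ *m _)]eY !mulmx_suml raddf_sum; apply: eq_bigr => l _.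
  by rewrite adjmxM -!mulmxA [RHS]mxtrace_mulC !mulmxA mxtrace_mulC !mulmxA.
have sq : \sum_l \tr (K l *m Y *m S *m adjmx (K l *m Y)) = \tr (Y *m S *m adjmx Y).
  rewrite -[X in _ = \tr (X *m _ *m _)]mul1mx -K1 !mulmx_suml raddf_sum; apply: eq_bigr => l _.
  by rewrite adjmxM -!mulmxA [RHS]mxtrace_mulC -!mulmxA.
have cross' : \sum_l \tr (K l *m Y *m S *m adjmx (Z l *m K l)) = \tr (Y *m S *m adjmx Y).
  transitivity (conjc (\tr (Y *m S *m adjmx Y))).
    rewrite -cross rmorph_sum; apply: eq_bigr => l _.
    by rewrite /= -mxtrace_adj !adjmxM !adjmxK (psdmx_adj psdS) !mulmxA.
  by rewrite -mxtrace_adj !adjmxM !adjmxK (psdmx_adj psdS) !mulmxA.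
apply/esym; transitivity (\sum_l (\tr (Z l *m (K l *m S *m adjmx (K l)) *m adjmx (Z l))
   - \tr (Z l *m K l *m S *m adjmx (K l *m Y)) - \tr (K l *m Y *m S *m adjmx (Z l *m K l))
   + \tr (K l *m Y *m S *m adjmx (K l *m Y)))).
  by apply: eq_bigr => l _; rewrite trace_sesquiB [adjmx (Z l *m K l)]adjmxM !mulmxA.
by rewrite big_split /= !sumrB cross cross' sq; ring.
Qed.

Lemma le_Re (x y : C) : x <= y -> complex.Re x <= complex.Re y.
Proof. by rewrite lecE => /andP[]. Qed.

(** * Data processing inequality for a channel with a classical output label *)

Section Monotonicity.
Variables (m n : nat) (J I : finType) (K : J -> I -> 'M[C]_(m, n)).
Variables (W : J -> 'M[C]_m) (rho sigma : 'M[C]_m) (om tau : 'M[C]_n).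
Hypothesis J_gt0 : (0 < #|J|)%N.
Hypothesis uW : forall j, Defs.unitarymx (W j).
Hypothesis K1 : \sum_j \sum_i adjmx (K j i) *m K j i = 1%:M.
Hypothesis Kom : forall j, \sum_i K j i *m om *m adjmx (K j i) =
  #|J|%:R^-1 *: (W j *m rho *m adjmx (W j)).
Hypothesis Ktau : forall j, \sum_i K j i *m tau *m adjmx (K j i) =
  #|J|%:R^-1 *: (W j *m sigma *m adjmx (W j)).
Hypotheses (pom : psdmx om) (ptau : psdmx tau) (prho : psdmx rho) (psig : psdmx sigma).

Let avg (a : C) : \sum_(j : J) #|J|%:R^-1 * a = a.
Proof. by rewrite sumr_const -[LHS]mulr_natl mulrA divff ?mul1r // pnatr_eq0 -lt0n. Qed.

(** The [K j i] are Kraus operators of a channel whose outcome [j] carries [rho] rotated by [W j]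
    with weight [1 / #|J|]. The form at [X] is the average over [j] of its copies rotated by [W j];
    pulling these back preserves the linear term, and [kraus_schwarz] shows that the two subtracted
    terms do not grow. *)
Lemma qform_mono (u : R) X : 0 < u < 1 ->
  exists Y, qform u rho sigma X <= qform u om tau Y.
Proof.
move=> /andP[u0 u1]; pose Z j := W j *m X *m adjmx (W j).
pose Y := \sum_j \sum_i adjmx (K j i) *m Z j *m K j i.
have adjZ j : adjmx (Z j) = W j *m adjmx X *m adjmx (W j).
  by rewrite !adjmxM adjmxK mulmxA.
have K1' : \sum_l adjmx (K l.1 l.2) *m K l.1 l.2 = 1%:M by rewrite -K1 pair_bigA.
have adjY : adjmx Y = \sum_j \sum_i adjmx (K j i) *m adjmx (Z j) *m K j i.
  rewrite adjmx_sum; apply: eq_bigr => j _; rewrite adjmx_sum; apply: eq_bigr => i _.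
  by rewrite adjmxM [adjmx (_ *m Z j)]adjmxM adjmxK mulmxA.
have trZ j (A B S : 'M[C]_m) :
    \tr ((W j *m A *m adjmx (W j)) *m (W j *m S *m adjmx (W j)) *m (W j *m B *m adjmx (W j))) =
    \tr (A *m S *m B).
  have uW' := unitarymxC (uW j).
  rewrite -!mulmxA mxtrace_mulC -!mulmxA uW' mulmx1.
  by rewrite (mulmxA _ (W j)) uW' mul1mx (mulmxA _ (W j)) uW' mul1mx.
(* Covers both quadratic terms: [V = X] with [om], and [V = adjmx X] with [tau]. *)
have key (T : 'M[C]_n) (S : 'M[C]_m) (V : 'M[C]_m) (V' := fun j => W j *m V *m adjmx (W j)) :
    psdmx T -> (forall j, \sum_i K j i *m T *m adjmx (K j i) =
      #|J|%:R^-1 *: (W j *m S *m adjmx (W j))) ->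
    \tr ((\sum_j \sum_i adjmx (K j i) *m V' j *m K j i) *m T *m
       adjmx (\sum_j \sum_i adjmx (K j i) *m V' j *m K j i)) <= \tr (V *m S *m adjmx V).
  move=> pT KT; rewrite pair_bigA /=.
  have := @kraus_schwarz _ _ _ _ (fun l : J * I => V' l.1) _ _ K1' pT erefl.
  move/le_trans; apply.
  rewrite -(pair_bigA _ (fun j i =>
    \tr (V' j *m (K j i *m T *m adjmx (K j i)) *m adjmx (V' j)))) /=.
  rewrite -[X in _ <= X]avg; apply: ler_sum => j _.
  rewrite -raddf_sum -mulmx_suml -mulmx_sumr KT -scalemxAr -scalemxAl /= mxtraceZ.
  by rewrite /V' !adjmxM adjmxK [W j *m (_ *m _)]mulmxA trZ.
exists Y; rewrite /qform.
have -> : \tr (adjmx Y *m om) = \tr (adjmx X *m rho).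
  rewrite adjY mulmx_suml raddf_sum -[RHS]avg; apply: eq_bigr => j _.
  rewrite mulmx_suml raddf_sum /=.
  transitivity (\tr (adjmx (Z j) *m \sum_i K j i *m om *m adjmx (K j i))).
    rewrite mulmx_sumr raddf_sum; apply: eq_bigr => i _.
    by rewrite -!mulmxA mxtrace_mulC !mulmxA.
  rewrite Kom -scalemxAr linearZ /= adjZ; congr (_ * _).
  by have := trZ j (adjmx X) 1%:M rho; rewrite !mulmx1 (uW j) mulmx1.
have hX : complex.Re (\tr (Y *m om *m adjmx Y)) <= complex.Re (\tr (X *m rho *m adjmx X)).
  by apply: le_Re; apply: key.
have hX' : complex.Re (\tr (adjmx Y *m tau *m Y)) <= complex.Re (\tr (adjmx X *m sigma *m X)).
  apply: le_Re; have := key tau sigma (adjmx X) ptau Ktau; rewrite adjmxK.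
  by under eq_bigr do under eq_bigr do rewrite -adjZ; rewrite -adjY adjmxK.
have := ler_wpM2l (ltW u0) hX'; have := ler_wpM2l (_ : 0 <= 1 - u) hX.
rewrite subr_ge0 ltW // => /(_ isT); lra.
Qed.

Lemma trace_mono (T : 'M[C]_n) (S : 'M[C]_m) :
  (forall j, \sum_i K j i *m T *m adjmx (K j i) =
      #|J|%:R^-1 *: (W j *m S *m adjmx (W j))) -> \tr T = \tr S.
Proof.
move=> KT; rewrite -[T]mul1mx -K1 mulmx_suml raddf_sum -[RHS]avg; apply: eq_bigr => j _.
transitivity (\tr (\sum_i K j i *m T *m adjmx (K j i))).
  rewrite mulmx_suml !raddf_sum; apply: eq_bigr => i _.
  by rewrite /= -mulmxA mxtrace_mulC.
by rewrite KT linearZ /= -mulmxA mxtrace_mulC -mulmxA (unitarymxC (uW j)) mulmx1.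
Qed.

(** A single label [j] suffices. For [v] in the kernel of [sigma], the nonnegative forms of [tau] at
    the vectors [adjmx (K j i) *m (W j *m v)] sum to 0, so these vectors lie in the kernel of [tau],
    hence of [om]. *)
Lemma supp_le_mono : supp_le om tau -> supp_le rho sigma.
Proof.
move=> supp v sv.
have J0 : (#|J|%:R^-1 : C) != 0 by rewrite invr_neq0 // pnatr_eq0 -lt0n.
case/card_gt0P: (J_gt0) => j _; have uW' := unitarymxC (uW j).
have z i : tau *m (adjmx (K j i) *m (W j *m v)) = 0.
  apply: psdmx_ker => //.
  have ge0 i' : 0 <= \tr (adjmx (adjmx (K j i') *m (W j *m v)) *m tau *m
       (adjmx (K j i') *m (W j *m v))).
    rewrite -{2}[_ *m (W j *m v)]adjmxK; exact: trace_psd_gram_ge0.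
  have : \sum_i' \tr (adjmx (adjmx (K j i') *m (W j *m v)) *m tau *m
       (adjmx (K j i') *m (W j *m v))) = 0.
    transitivity (\tr (adjmx (W j *m v) *m
        (\sum_i' K j i' *m tau *m adjmx (K j i')) *m (W j *m v))).
      rewrite mulmx_sumr mulmx_suml raddf_sum; apply: eq_bigr => i' _.
      by rewrite adjmxM adjmxK !mulmxA.
    rewrite Ktau -scalemxAr -scalemxAl -!mulmxA (mulmxA (adjmx (W j))) uW' mul1mx sv.
    by rewrite !mulmx0 scaler0 raddf0.
  move/eqP; rewrite psumr_eq0 // => /allP /(_ i (mem_index_enum _)) /=.
  by move/eqP.
have : (\sum_i K j i *m om *m adjmx (K j i)) *m (W j *m v) = 0.
  rewrite mulmx_suml big1 // => i _.
  by rewrite -!mulmxA supp ?mulmx0 // z.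
rewrite Kom -scalemxAl => /eqP; rewrite scaler_eq0 (negPf J0) /= => /eqP.
move=> /(congr1 (mulmx (adjmx (W j)))); rewrite mulmx0 !mulmxA uW' mul1mx.
by rewrite -!mulmxA (mulmxA (adjmx (W j))) uW' mul1mx.
Qed.

Theorem relent_mono : supp_le om tau -> (relent rho sigma <= relent om tau)%E.
Proof.
move=> supp; have supp' := supp_le_mono supp.
rewrite /relent !asboolT // lee_fin.
have [r er r0] := psdmx_spectral prho; have [s es s0] := psdmx_spectral psig.
have [r' er' r0'] := psdmx_spectral pom; have [s' es' s0'] := psdmx_spectral ptau.
rewrite (relent_overlap prho er es) (relent_overlap pom er' es').
have approx_mono k : overlap_sum r s (relent_approx k) <= overlap_sum r' s' (relent_approx k).
  (* Summing over the nodes last isolates the [quad_term] sums, to which the quadratic forms apply;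
     the remaining sums are traces, preserved by [trace_mono]. *)
  have expand N (t1 t2 : 'M[C]_N * 'rV[R]_N) : overlap_sum t1 t2 (relent_approx k) =
      \sum_(l < k) (l.+1%:R)^-1 * (overlap_sum t1 t2 (quad_term (l.+1%:R / k.+1%:R)) -
         overlap_sum t1 t2 (fun x _ => x)).
    under eq_bigr do rewrite overlap_sumB /overlap_sum mulr_sumr.
    rewrite exchange_big; apply: eq_bigr => i _.
    under eq_bigr do rewrite mulr_sumr.
    rewrite exchange_big; apply: eq_bigr => j _.
    by rewrite /relent_approx mulr_sumr; apply: eq_bigr => l _; ring.
  rewrite !expand; apply: ler_sum => l _.
  rewrite -(trace_overlap prho er es.1) -(trace_overlap pom er' es'.1) (trace_mono Kom).
  rewrite ler_wpM2l ?invr_ge0 ?ler0n // lerD2r.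
  have u01 : 0 < (l.+1%:R / k.+1%:R : R) < 1.
    by rewrite divr_gt0 ?ltr0n //= ltr_pdivrMr ?ltr0n // mul1r ltr_nat ltnS.
  have [X <-] := qform_max u01 prho psig er es.
  have [Y /le_trans -> //] := qform_mono X u01.
  exact: qform_le.
pose err (p q : R) : R := `|q - p| + (q - p) ^+ 2 / q.
have errZ N (t1 t2 : 'M[C]_N * 'rV[R]_N) k :
    overlap_sum t1 t2 (fun p q => err p q / k.+1%:R) = overlap_sum t1 t2 err / k.+1%:R.
  rewrite /overlap_sum mulr_suml; apply: eq_bigr => i _.
  by rewrite mulr_suml; apply: eq_bigr => j _; rewrite mulrA.
(* The constant adds the approximation errors of the two sides; both are of order [1 / k.+1], so
   they vanish in the limit. *)
apply: (@ler_archi_inv _ _ _ (overlap_sum r s err + overlap_sum r' s' err)) => k.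
have h1 : overlap_sum r s (@relent_term R) - overlap_sum r s (relent_approx k) <=
    overlap_sum r s err / k.+1%:R.
  rewrite overlap_sumB -errZ; apply: overlap_sum_le => i j o0.
  apply: le_trans (ler_norm _) _; apply: relent_termP => //.
  exact: (supp_le_overlap supp' er es o0).
have h2 : overlap_sum r' s' (relent_approx k) - overlap_sum r' s' (@relent_term R) <=
    overlap_sum r' s' err / k.+1%:R.
  rewrite overlap_sumB -errZ; apply: overlap_sum_le => i j o0.
  apply: le_trans (ler_norm _) _; rewrite distrC; apply: relent_termP => //.
  exact: (supp_le_overlap supp er' es' o0).
rewrite mulrDl addrA -lerBlDr; apply: le_trans (lerB (lexx _) h2) _.
move: h1 (approx_mono k).
move: (overlap_sum r s err / _) (overlap_sum r s _) (overlap_sum r s _).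
move=> E A B; move: (overlap_sum r' s' _) (overlap_sum r' s' _) => A' B'.
lra.
Qed.

End Monotonicity.

(** * Klein's inequality and unitary invariance *)

Lemma relent_ge0 n (rho sigma : 'M[C]_n) : psdmx rho -> psdmx sigma ->
  \tr rho = \tr sigma -> (0 <= relent rho sigma)%E.
Proof.
move=> prho psig tr_eq; rewrite /relent; case: asboolP => [supp|_]; last exact: leey.
have [r er r0] := psdmx_spectral prho; have [s es s0] := psdmx_spectral psig.
rewrite lee_fin (relent_overlap prho er es).
suff -> : 0 = overlap_sum r s (fun p q => p - q).
  apply: overlap_sum_le => i j o0; apply: relent_term_ge => //.
  exact: (supp_le_overlap supp er es o0).
rewrite -(overlap_sumB r s (fun p _ => p) (fun _ q => q)).
by rewrite -(trace_overlap prho er es.1) -(trace_overlapr psig es er.1) tr_eq subrr.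
Qed.

Lemma relent_conj m n (P : 'M[C]_(m, n)) (rho sigma : 'M[C]_n) :
  P *m adjmx P = 1%:M -> adjmx P *m P = 1%:M -> psdmx rho -> psdmx sigma ->
  relent (P *m rho *m adjmx P) (P *m sigma *m adjmx P) = relent rho sigma.
Proof.
move=> PP1 PP2 prho psig; rewrite /relent.
have -> : `[< supp_le (P *m rho *m adjmx P) (P *m sigma *m adjmx P) >] =
    `[< supp_le rho sigma >].
  apply/asbool_equiv_eq; split => h v.
    have := h (P *m v); rewrite -!mulmxA !(mulmxA (adjmx P) P) PP2 !mul1mx => hv sv.
    have : adjmx P *m (P *m (rho *m v)) = 0 by rewrite hv ?mulmx0 // sv mulmx0.
    by rewrite mulmxA PP2 mul1mx.
  rewrite -!mulmxA => /(congr1 (mulmx (adjmx P))).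
  by rewrite mulmx0 mulmxA PP2 mul1mx => /h ->; rewrite mulmx0.
case: asboolP => // _; congr ((complex.Re _)%:E).
rewrite /mxlog !mxfun_conj // -mulmxBl -mulmxBr.
rewrite -!mulmxA (mulmxA (adjmx P) P) PP2 mul1mx mxtrace_mulC.
by rewrite -!mulmxA PP2 mulmx1.
Qed.

End RelativeEntropy.

(** * Tensor products, reordering of factors, partial trace and the maximally entangled state *)

Section Tensor.
Variable R : realType.
Local Notation C := (R[i]).

Lemma pidx_eq m n (i j : 'I_m) (k l : 'I_n) :
  (pidx i k == pidx j l) = (i == j) && (k == l).
Proof.
apply/eqP/andP => [|[/eqP -> /eqP ->]] //.
have /= [g gK _] := curry_mxvec_bij m n.
have gE a b : g (pidx a b) = (a, b) by rewrite -(gK (a, b)).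
by move/(congr1 g); rewrite !gE => -[-> ->].
Qed.

Lemma sum_pidx (V : nmodType) m n (F : 'I_(m * n) -> V) :
  \sum_x F x = \sum_i \sum_k F (pidx i k).
Proof.
rewrite pair_bigA (reindex _ (curry_mxvec_bij m n)).
by apply: eq_big => [|[i k] _]; [case|].
Qed.

Lemma mx_pidxP m1 m2 n1 n2 (A B : 'M[C]_(m1 * m2, n1 * n2)) :
  (forall i k j l, A (pidx i k) (pidx j l) = B (pidx i k) (pidx j l)) -> A = B.
Proof.
move=> AB; apply/matrixP => x y.
by case/mxvec_indexP: x => i k; case/mxvec_indexP: y => j l; apply: AB.
Qed.

(** Serves to read entries of [tensmx] and [mid_swap], which are sums of matrix units at pairwise
    distinct positions. *)
Lemma delta_sumE (T : finType) m n (F : T -> C) (f : T -> 'I_m) (g : T -> 'I_n) t :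
  (forall t1 t2, f t1 = f t2 -> g t1 = g t2 -> t1 = t2) ->
  (\sum_s F s *: delta_mx (f s) (g s)) (f t) (g t) = F t.
Proof.
move=> inj; rewrite summxE (bigD1 t) //= big1 => [|s st].
  by rewrite !mxE !eqxx mulr1 addr0.
rewrite !mxE; case: eqP => [e1|]; last by rewrite mulr0.
case: eqP => [e2|]; last by rewrite mulr0.
by rewrite (inj _ _ e1 e2) eqxx in st.
Qed.

Lemma tensmxE m1 n1 m2 n2 (A : 'M[C]_(m1, n1)) (B : 'M[C]_(m2, n2)) i k j l :
  tensmx A B (pidx i k) (pidx j l) = A i j * B k l.
Proof.
rewrite /tensmx !pair_bigA /=.
pose f (t : 'I_m1 * 'I_n1 * 'I_m2 * 'I_n2) := pidx t.1.1.1 t.1.2.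
pose g (t : 'I_m1 * 'I_n1 * 'I_m2 * 'I_n2) := pidx t.1.1.2 t.2.
apply: (@delta_sumE _ _ _ (fun t => A t.1.1.1 t.1.1.2 * B t.1.2 t.2) f g (i, j, k, l)).
move=> [[[a b] c] d] [[[a' b'] c'] d']; rewrite /f /g /=.
by move=> /eqP + /eqP; rewrite !pidx_eq => /andP[/eqP -> /eqP ->] /andP[/eqP -> /eqP ->].
Qed.

Lemma tensmxM m1 n1 p1 m2 n2 p2 (A : 'M[C]_(m1, n1)) (B : 'M[C]_(m2, n2))
    (A' : 'M[C]_(n1, p1)) (B' : 'M[C]_(n2, p2)) :
  tensmx A B *m tensmx A' B' = tensmx (A *m A') (B *m B').
Proof.
apply: mx_pidxP => i k j l; rewrite tensmxE !mxE sum_pidx mulr_suml.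
apply: eq_bigr => x _; rewrite mulr_sumr; apply: eq_bigr => y _.
by rewrite !tensmxE; ring.
Qed.

Lemma adj_tensmx m1 n1 m2 n2 (A : 'M[C]_(m1, n1)) (B : 'M[C]_(m2, n2)) :
  adjmx (tensmx A B) = tensmx (adjmx A) (adjmx B).
Proof. by apply: mx_pidxP => i k j l; rewrite adjmxE !tensmxE !adjmxE rmorphM. Qed.

Lemma tensmx11 m n : tensmx 1%:M 1%:M = 1%:M :> 'M[C]_(m * n).
Proof. by apply: mx_pidxP => i k j l; rewrite tensmxE !mxE pidx_eq -natrM mulnb. Qed.

Lemma tensmxZl m1 n1 m2 n2 c (A : 'M[C]_(m1, n1)) (B : 'M[C]_(m2, n2)) :
  tensmx (c *: A) B = c *: tensmx A B.
Proof. by apply: mx_pidxP => i k j l; rewrite mxE !tensmxE mxE mulrA. Qed.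

Lemma tensmxZr m1 n1 m2 n2 c (A : 'M[C]_(m1, n1)) (B : 'M[C]_(m2, n2)) :
  tensmx A (c *: B) = c *: tensmx A B.
Proof. by apply: mx_pidxP => i k j l; rewrite mxE !tensmxE mxE; ring. Qed.

Lemma tensmxDr m1 n1 m2 n2 (A : 'M[C]_(m1, n1)) (B B' : 'M[C]_(m2, n2)) :
  tensmx A (B + B') = tensmx A B + tensmx A B'.
Proof. by apply: mx_pidxP => i k j l; rewrite mxE !tensmxE mxE mulrDr. Qed.

Lemma tensmx_suml m1 n1 m2 n2 (I : finType) (A : I -> 'M[C]_(m1, n1)) (B : 'M[C]_(m2, n2)) :
  tensmx (\sum_i A i) B = \sum_i tensmx (A i) B.
Proof.
apply: mx_pidxP => i k j l; rewrite tensmxE !summxE mulr_suml.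
by apply: eq_bigr => x _; rewrite tensmxE.
Qed.

Lemma tensmx_sumr m1 n1 m2 n2 (I : finType) (A : 'M[C]_(m1, n1)) (B : I -> 'M[C]_(m2, n2)) :
  tensmx A (\sum_i B i) = \sum_i tensmx A (B i).
Proof.
apply: mx_pidxP => i k j l; rewrite tensmxE !summxE mulr_sumr.
by apply: eq_bigr => x _; rewrite tensmxE.
Qed.

Lemma trace_tensmx m n (A : 'M[C]_m) (B : 'M[C]_n) : \tr (tensmx A B) = \tr A * \tr B.
Proof.
rewrite /mxtrace sum_pidx mulr_suml; apply: eq_bigr => i _.
by rewrite mulr_sumr; apply: eq_bigr => k _; rewrite tensmxE.
Qed.

Lemma tensmx_delta m1 n1 m2 n2 (i : 'I_m1) (j : 'I_n1) (k : 'I_m2) (l : 'I_n2) :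
  tensmx (delta_mx i j) (delta_mx k l) = delta_mx (pidx i k) (pidx j l) :> 'M[C]_(_, _).
Proof.
by apply: mx_pidxP => x y z w; rewrite tensmxE !mxE !pidx_eq -natrM mulnb andbACA.
Qed.

Lemma tensmx_unitary m n (U : 'M[C]_m) (V : 'M[C]_n) :
  Defs.unitarymx U -> Defs.unitarymx V -> Defs.unitarymx (tensmx U V).
Proof.
by move=> uU uV; rewrite /Defs.unitarymx adj_tensmx tensmxM uU uV tensmx11.
Qed.

Lemma mx_tens_sum m n (X : 'M[C]_(m * n)) :
  X = \sum_i \sum_j \sum_k \sum_l
        X (pidx i k) (pidx j l) *: tensmx (delta_mx i j) (delta_mx k l).
Proof.
rewrite {1}(matrix_sum_delta X) sum_pidx; apply: eq_bigr => i _.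
rewrite [RHS]exchange_big; apply: eq_bigr => k _.
rewrite sum_pidx; apply: eq_bigr => j _; apply: eq_bigr => l _.
by rewrite tensmx_delta.
Qed.

Section LinearMaps.
Variables (m n : nat) (K : 'M[C]_m -> 'M[C]_n).
Hypothesis linK : linear K.

Lemma linmapD X Y : K (X + Y) = K X + K Y.
Proof. by have := linK 1 X Y; rewrite !scale1r. Qed.

Lemma linmap0 : K 0 = 0.
Proof. by have /(congr1 (fun x => x - K 0)) := linmapD 0 0; rewrite addr0 subrr addrK. Qed.

Lemma linmapZ c X : K (c *: X) = c *: K X.
Proof. by have := linK c X 0; rewrite linmap0 !addr0. Qed.

Lemma linmap_sum (I : finType) (F : I -> 'M[C]_m) : K (\sum_i F i) = \sum_i K (F i).
Proof. exact: (big_morph _ linmapD linmap0). Qed.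

End LinearMaps.

Lemma linear_tens_ext m n p (K L : 'M[C]_(m * n) -> 'M[C]_p) : linear K -> linear L ->
  (forall A B, K (tensmx A B) = L (tensmx A B)) -> forall X, K X = L X.
Proof.
move=> linK linL KL X; rewrite (mx_tens_sum X).
by do 4![rewrite !(linmap_sum linK) !(linmap_sum linL); apply: eq_bigr => ? _];
  rewrite !(linmapZ linK) !(linmapZ linL) KL.
Qed.

Lemma linear_conj m n (A : 'M[C]_(m, n)) : linear (fun X : 'M[C]_n => A *m X *m adjmx A).
Proof. by move=> c X Y; rewrite mulmxDr mulmxDl -scalemxAr -scalemxAl. Qed.

Lemma linear_comp_map m n p (K : 'M[C]_n -> 'M[C]_p) (L : 'M[C]_m -> 'M[C]_n) :
  linear K -> linear L -> linear (fun X => K (L X)).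
Proof. by move=> linK linL c X Y; rewrite linL linK. Qed.

Lemma tmap_linear m1 m2 n1 n2 (K : 'M[C]_m1 -> 'M[C]_m2) (L : 'M[C]_n1 -> 'M[C]_n2) :
  linear (tmap K L).
Proof.
move=> c X Y; rewrite /tmap scaler_sumr -big_split; apply: eq_bigr => i _.
rewrite scaler_sumr -big_split; apply: eq_bigr => j _.
rewrite scaler_sumr -big_split; apply: eq_bigr => k _.
rewrite scaler_sumr -big_split; apply: eq_bigr => l _.
by rewrite !mxE scalerDl scalerA.
Qed.

Lemma tmap_tens m1 m2 n1 n2 (K : 'M[C]_m1 -> 'M[C]_m2) (L : 'M[C]_n1 -> 'M[C]_n2) A B :
  linear K -> linear L -> tmap K L (tensmx A B) = tensmx (K A) (L B).
Proof.
move=> linK linL; rewrite [A in RHS]matrix_sum_delta (linmap_sum linK) tensmx_suml.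
apply: eq_bigr => i _; rewrite (linmap_sum linK) tensmx_suml; apply: eq_bigr => j _.
rewrite [B in RHS]matrix_sum_delta (linmap_sum linL) tensmx_sumr.
apply: eq_bigr => k _; rewrite (linmap_sum linL) tensmx_sumr; apply: eq_bigr => l _.
by rewrite tensmxE (linmapZ linK) (linmapZ linL) tensmxZl tensmxZr scalerA.
Qed.

Lemma idtensorE r m n (K : 'M[C]_m -> 'M[C]_n) (X : 'M[C]_(r * m)) x y z w :
  idtensor K X (pidx x y) (pidx z w) =
  \sum_k \sum_l X (pidx x k) (pidx z l) * K (delta_mx k l) y w.
Proof.
rewrite /idtensor /tmap summxE (bigD1 x) //= [X in _ + X]big1 => [|i ix]; last first.
  rewrite summxE big1 // => j _; rewrite summxE big1 // => k _; rewrite summxE big1 // => l _.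
  by rewrite mxE tensmxE mxE eq_sym (negPf ix) mul0r mulr0.
rewrite addr0 summxE (bigD1 z) //= [X in _ + X]big1 => [|j jz]; last first.
  rewrite summxE big1 // => k _; rewrite summxE big1 // => l _.
  by rewrite mxE tensmxE mxE [z == j]eq_sym (negPf jz) andbF mul0r mulr0.
rewrite addr0 summxE; apply: eq_bigr => k _; rewrite summxE; apply: eq_bigr => l _.
by rewrite mxE tensmxE mxE !eqxx mul1r.
Qed.

Lemma mid_swapE p q s t (X : 'M[C]_((p * q) * (s * t))) a b c d a' b' c' d' :
  mid_swap X (pidx (pidx a c) (pidx b d)) (pidx (pidx a' c') (pidx b' d')) =
  X (pidx (pidx a b) (pidx c d)) (pidx (pidx a' b') (pidx c' d')).
Proof.
rewrite /mid_swap !pair_bigA /=.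
pose T := ('I_p * 'I_p * 'I_q * 'I_q * 'I_s * 'I_s * 'I_t * 'I_t)%type.
pose f (u : T) := pidx (pidx u.1.1.1.1.1.1.1 u.1.1.1.2) (pidx u.1.1.1.1.1.2 u.1.2).
pose g (u : T) := pidx (pidx u.1.1.1.1.1.1.2 u.1.1.2) (pidx u.1.1.1.1.2 u.2).
pose F (u : T) := X (pidx (pidx u.1.1.1.1.1.1.1 u.1.1.1.1.1.2) (pidx u.1.1.1.2 u.1.2))
  (pidx (pidx u.1.1.1.1.1.1.2 u.1.1.1.1.2) (pidx u.1.1.2 u.2)).
apply: (@delta_sumE _ _ _ F f g (a, a', b, b', c, c', d, d')).
case=> [[[[[[[? ?] ?] ?] ?] ?] ?] ?]; case=> [[[[[[[? ?] ?] ?] ?] ?] ?] ?].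
rewrite /f /g /= => /eqP + /eqP; rewrite !pidx_eq.
move=> /andP[/andP[/eqP -> /eqP ->] /andP[/eqP -> /eqP ->]].
by move=> /andP[/andP[/eqP -> /eqP ->] /andP[/eqP -> /eqP ->]].
Qed.

Lemma adj_rowsub1 p q (h : 'I_p -> 'I_q) :
  adjmx (rowsub h 1%:M) = colsub h 1%:M :> 'M[C]_(q, p).
Proof. by apply/matrixP => i j; rewrite adjmxE !mxE eq_sym rmorph_nat. Qed.

(** Reordering factors is conjugation by a permutation matrix, so it preserves positivity, trace and
    relative entropy. *)
Lemma mid_swap_unitary p q s t : exists P : 'M[C]_((p * s) * (q * t), (p * q) * (s * t)),
  [/\ P *m adjmx P = 1%:M, adjmx P *m P = 1%:M &
      forall X, mid_swap X = P *m X *m adjmx P].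
Proof.
have /= [g gK _] := curry_mxvec_bij (p * s) (q * t).
have /= [g1 g1K _] := curry_mxvec_bij p s.
have /= [g2 g2K _] := curry_mxvec_bij q t.
(* The index permutation, with [g], [g1], [g2] decoding pairs; selecting rows of the identity along
   [h] gives [P]. *)
pose h x : 'I_((p * q) * (s * t)) :=
  pidx (pidx (g1 (g x).1).1 (g2 (g x).2).1) (pidx (g1 (g x).1).2 (g2 (g x).2).2).
have hE a b c d : h (pidx (pidx a c) (pidx b d)) = pidx (pidx a b) (pidx c d).
  have gE x y : g (pidx x y) = (x, y) by rewrite -(gK (x, y)).
  have g1E x y : g1 (pidx x y) = (x, y) by rewrite -(g1K (x, y)).
  have g2E x y : g2 (pidx x y) = (x, y) by rewrite -(g2K (x, y)).
  by rewrite /h !(gE, g1E, g2E).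
have conjE (X : 'M[C]_((p * q) * (s * t))) :
    mid_swap X = rowsub h 1%:M *m X *m adjmx (rowsub h 1%:M).
  rewrite mul_rowsub_mx mul1mx.
  have -> : rowsub h X *m adjmx (rowsub h 1%:M) = colsub h (rowsub h X).
    by rewrite adj_rowsub1 mulmx_colsub mulmx1.
  apply: mx_pidxP => x y z w.
  case/mxvec_indexP: x => a c; case/mxvec_indexP: y => b d.
  case/mxvec_indexP: z => a' c'; case/mxvec_indexP: w => b' d'.
  by rewrite mid_swapE !mxE !hE.
exists (rowsub h 1%:M); split => //.
  (* [P *m adjmx P] is [mid_swap] of the identity. *)
  rewrite -[rowsub h 1%:M in X in X *m _]mulmx1 -conjE; apply: mx_pidxP => x y z w.
  case/mxvec_indexP: x => a c; case/mxvec_indexP: y => b d.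
  case/mxvec_indexP: z => a' c'; case/mxvec_indexP: w => b' d'.
  by rewrite mid_swapE !mxE !pidx_eq; congr (_%:R); congr nat_of_bool; rewrite andbACA.
apply: mx_pidxP => x y z w.
case/mxvec_indexP: x => a b; case/mxvec_indexP: y => c d.
case/mxvec_indexP: z => a' b'; case/mxvec_indexP: w => c' d'.
rewrite mxE (bigD1 (pidx (pidx a c) (pidx b d))) //= big1 => [|u une].
  by rewrite adjmxE !mxE hE eqxx rmorph1 mul1r addr0.
move: une; case/mxvec_indexP: u => x y; case/mxvec_indexP: x => a1 c1.
case/mxvec_indexP: y => b1 d1.
rewrite -![mxvec_index _ _]/(pidx _ _) adjmxE !mxE hE !pidx_eq andbACA => /negPf ->.
by rewrite rmorph0 mul0r.
Qed.

Lemma mid_swapK p q s t (X : 'M[C]_((p * q) * (s * t))) : mid_swap (mid_swap X) = X.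
Proof.
apply: mx_pidxP => x y z w.
case/mxvec_indexP: x => a c; case/mxvec_indexP: y => b d.
case/mxvec_indexP: z => a' c'; case/mxvec_indexP: w => b' d'.
by rewrite !mid_swapE.
Qed.

(** The operator [<i|] tensor identity; these are the Kraus operators of the partial trace. *)
Definition slice m n (i : 'I_m) : 'M[C]_(n, m * n) := rowsub (pidx i) 1%:M.

Lemma adj_slice m n (i : 'I_m) : adjmx (slice n i) = colsub (pidx i) 1%:M.
Proof. exact: adj_rowsub1. Qed.

Lemma ptrace1_slice m n (X : 'M[C]_(m * n)) :
  ptrace1 X = \sum_i slice n i *m X *m adjmx (slice n i).
Proof.
apply/matrixP => k l; rewrite mxE summxE; apply: eq_bigr => i _.
by rewrite adj_slice mul_rowsub_mx mul1mx mulmx_colsub mulmx1 !mxE.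
Qed.

Lemma slice_tensmx m n (i : 'I_m) (S : 'M[C]_n) :
  slice n i *m tensmx 1%:M S = S *m slice n i.
Proof.
rewrite mul_rowsub_mx mul1mx; apply/matrixP => k x; case/mxvec_indexP: x => j l.
rewrite mxE tensmxE mxE; have [->|ij] := eqVneq i j.
  rewrite mul1r mxE (bigD1 l) //= !mxE eqxx mulr1 big1 ?addr0 // => y yl.
  by rewrite !mxE pidx_eq (negPf yl) andbF mulr0.
by rewrite mul0r mxE big1 // => y _; rewrite !mxE pidx_eq (negPf ij) mulr0.
Qed.

Lemma tensmx_slice m n (i : 'I_m) (S : 'M[C]_n) :
  tensmx 1%:M S *m adjmx (slice n i) = adjmx (slice n i) *m S.
Proof.
rewrite -[LHS]adjmxK adjmxM adjmxK adj_tensmx adjmx1 slice_tensmx.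
by rewrite adjmxM adjmxK.
Qed.

Lemma sum_slice m n : \sum_i adjmx (slice n i) *m slice n i = 1%:M :> 'M[C]_(m * n).
Proof.
apply: mx_pidxP => i k j l; rewrite summxE (bigD1 i) //= big1 => [|x xi].
  rewrite addr0 adj_slice mxE (bigD1 k) //= big1 => [|y yk].
    by rewrite !mxE eqxx mul1r addr0.
  by rewrite !mxE pidx_eq [k == y]eq_sym (negPf yk) andbF mul0r.
rewrite adj_slice mxE big1 // => y _.
by rewrite !mxE pidx_eq [i == x]eq_sym (negPf xi) mul0r.
Qed.

Lemma psdmx_ptrace1 m n (X : 'M[C]_(m * n)) : psdmx X -> psdmx (ptrace1 X).
Proof.
by move=> pX; rewrite ptrace1_slice; apply: psdmx_sum => i; apply: psdmx_conj.
Qed.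

Lemma trace_tensmx1 m n (X : 'M[C]_(m * n)) (Z : 'M[C]_n) :
  \tr (X *m tensmx 1%:M Z) = \tr (ptrace1 X *m Z).
Proof.
rewrite -[tensmx _ _]mulmx1 -sum_slice ptrace1_slice mulmx_suml !mulmx_sumr !raddf_sum.
apply: eq_bigr => i _ /=; rewrite (mulmxA (tensmx _ _)) tensmx_slice -!mulmxA.
by rewrite [RHS]mxtrace_mulC -!mulmxA.
Qed.

Lemma trace_ptrace1 m n (X : 'M[C]_(m * n)) : \tr (ptrace1 X) = \tr X.
Proof. by rewrite -[ptrace1 X]mulmx1 -trace_tensmx1 tensmx11 mulmx1. Qed.

Lemma ptrace1_linear m n : linear (@ptrace1 R m n).
Proof.
move=> c X Y; apply/matrixP => k l; rewrite !mxE mulr_sumr -big_split.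
by apply: eq_bigr => i _; rewrite !mxE.
Qed.

Lemma ptrace1_tens m n (A : 'M[C]_m) (B : 'M[C]_n) : ptrace1 (tensmx A B) = \tr A *: B.
Proof.
apply/matrixP => k l; rewrite !mxE mulr_suml.
by apply: eq_bigr => i _; rewrite tensmxE.
Qed.

Lemma ptrace1_conj m n p (U : 'M[C]_m) (V : 'M[C]_(p, n)) X : Defs.unitarymx U ->
  ptrace1 (tensmx U V *m X *m adjmx (tensmx U V)) = V *m ptrace1 X *m adjmx V.
Proof.
move=> uU; move: X; apply: linear_tens_ext.
- by apply: linear_comp_map; [apply: ptrace1_linear | apply: linear_conj].
- by apply: (linear_comp_map (@linear_conj _ _ V)); apply: ptrace1_linear.
move=> A B; rewrite adj_tensmx !tensmxM !ptrace1_tens -scalemxAr -scalemxAl.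
by congr (_ *: _); rewrite mxtrace_mulC mulmxA unitarymxC // mul1mx.
Qed.

Lemma Rmap_linear m n : linear (@Rmap R m n).
Proof. by move=> c X Y; rewrite /Rmap linearD linearZ /= scalerDl scalerA. Qed.

Lemma tmap_Rmap m n p q (M : 'M[C]_n -> 'M[C]_q) (X : 'M[C]_(m * n)) : linear M ->
  tmap (@Rmap R m p) M X = tensmx 1%:M (M (ptrace1 X)).
Proof.
move=> linM; move: X; apply: linear_tens_ext; first exact: tmap_linear.
  move=> c X Y; rewrite ptrace1_linear linM tensmxDr tensmxZr //.
move=> A B; rewrite tmap_tens //; last exact: Rmap_linear.
by rewrite ptrace1_tens linmapZ // tensmxZr /Rmap tensmxZl.
Qed.

Lemma maxentE n (i j k l : 'I_n) :
  maxent R n (pidx i k) (pidx j l) = n%:R^-1 * ((i == k) && (j == l))%:R.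
Proof.
rewrite /maxent mxE summxE; congr (_ * _).
rewrite (bigD1 i) //= [X in _ + X]big1 => [|i' ii']; last first.
  by rewrite summxE big1 // => j' _; rewrite mxE pidx_eq eq_sym (negPf ii').
rewrite addr0 summxE (bigD1 j) //= [X in _ + X]big1 => [|j' jj']; last first.
  by rewrite mxE !pidx_eq [j == j']eq_sym (negPf jj') andbF.
by rewrite addr0 mxE !pidx_eq !eqxx /= [i == k]eq_sym [j == l]eq_sym.
Qed.

(** Lets the bipartite Choi state be treated as that of a map with a single input of dimension
    [m * n]. *)
Lemma maxent_prod m n :
  mid_swap (tensmx (maxent R m) (maxent R n)) = maxent R (m * n).
Proof.
apply: mx_pidxP => x y z w.
case/mxvec_indexP: x => a c; case/mxvec_indexP: y => b d.
case/mxvec_indexP: z => a' c'; case/mxvec_indexP: w => b' d'.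
rewrite mid_swapE tensmxE !maxentE !pidx_eq natrM invfM mulrACA -natrM mulnb.
by rewrite andbACA.
Qed.

Lemma maxent_state n : (0 < n)%N -> state (maxent R n).
Proof.
move=> n0; split.
  pose v : 'cV[C]_(n * n) := \sum_i delta_mx (pidx i i) 0.
  have -> : maxent R n = n%:R^-1 *: (v *m adjmx v).
    rewrite /maxent; congr (_ *: _); rewrite /v adjmx_sum mulmx_suml.
    apply: eq_bigr => i _; rewrite mulmx_sumr; apply: eq_bigr => j _.
    by rewrite adjmx_delta mul_delta_mx.
  by apply: psdmxZ; [rewrite invr_ge0 ler0n | apply: psdmx_gram].
rewrite /mxtrace sum_pidx.
under eq_bigr => i _.
  rewrite (bigD1 i) //= big1 => [|k ki]; last first.
    by rewrite maxentE [i == k]eq_sym (negPf ki) mulr0.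
  rewrite maxentE !eqxx addr0 mulr1; over.
by rewrite sumr_const card_ord -[LHS]mulr_natl divff // pnatr_eq0 -lt0n.
Qed.

End Tensor.

(** * Choi states, covariance and the bound on the channel divergence *)

Section ChoiState.
Variable R : realType.
Local Notation C := (R[i]).

(** Here the whole reference precedes the whole output; [choi] regroups the factors by party. *)
Definition choi_state m n (K : 'M[C]_m -> 'M[C]_n) : 'M[C]_(m * n) :=
  idtensor K (maxent R m).

Lemma choi_stateE m n (K : 'M[C]_m -> 'M[C]_n) k y l w :
  choi_state K (pidx k y) (pidx l w) = m%:R^-1 * K (delta_mx k l) y w.
Proof.
rewrite /choi_state idtensorE (bigD1 k) //= [X in _ + X]big1 => [|k' kk']; last first.
  by rewrite big1 // => l' _; rewrite maxentE [k == k']eq_sym (negPf kk') mulr0 mul0r.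
rewrite addr0 (bigD1 l) //= [X in _ + X]big1 => [|l' ll']; last first.
  by rewrite maxentE [l == l']eq_sym (negPf ll') andbF mulr0 mul0r.
by rewrite addr0 maxentE !eqxx mulr1.
Qed.

Lemma trace_choi_state m n (K : 'M[C]_m -> 'M[C]_n) : (0 < m)%N ->
  (forall X, \tr (K X) = \tr X) -> \tr (choi_state K) = 1.
Proof.
move=> m0 trK; rewrite {1}/mxtrace sum_pidx.
under eq_bigr => k _ do under eq_bigr => y _ do rewrite choi_stateE.
under eq_bigr => k _.
  rewrite -mulr_sumr -[\sum_y _]/(\tr (K (delta_mx k k))) trK.
  have -> : \tr (delta_mx k k) = 1 :> C.
    rewrite /mxtrace (bigD1 k) //= big1 ?mxE ?eqxx ?addr0 // => j jk.
    by rewrite mxE (negPf jk).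
  rewrite mulr1; over.
by rewrite sumr_const card_ord -[LHS]mulr_natl divff // pnatr_eq0 -lt0n.
Qed.

Lemma conj_tens1E r m n (T : 'M[C]_(r, m)) (X : 'M[C]_(m * n)) x y z w :
  (tensmx T 1%:M *m X *m adjmx (tensmx T 1%:M)) (pidx x y) (pidx z w) =
  \sum_k \sum_l T x k * X (pidx k y) (pidx l w) * conjc (T z l).
Proof.
have mulE p (Y : 'M[C]_(m * n, p)) v :
    (tensmx T 1%:M *m Y) (pidx x y) v = \sum_k T x k * Y (pidx k y) v.
  rewrite mxE sum_pidx; apply: eq_bigr => k _.
  rewrite (bigD1 y) //= [X in _ + X]big1 => [|y' yy'].
    by rewrite tensmxE mxE eqxx mulr1 addr0.
  by rewrite tensmxE mxE eq_sym (negPf yy') mulr0 mul0r.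
rewrite -mulmxA mulE; apply: eq_bigr => k _.
rewrite -[_ *m adjmx _]adjmxK adjmxE adjmxM adjmxK.
rewrite mxE sum_pidx rmorph_sum mulr_sumr; apply: eq_bigr => l _.
rewrite (bigD1 w) //= [X in _ + X]big1 => [|w' ww'].
  by rewrite tensmxE mxE eqxx mulr1 addr0 rmorphM /= adjmxE conjcK; ring.
by rewrite tensmxE mxE eq_sym (negPf ww') mulr0 mul0r.
Qed.

Lemma conj_1tensE m n p (V : 'M[C]_(p, n)) (X : 'M[C]_(m * n)) x y z w :
  (tensmx 1%:M V *m X *m adjmx (tensmx 1%:M V)) (pidx x y) (pidx z w) =
  (V *m (\matrix_(k, l) X (pidx x k) (pidx z l)) *m adjmx V) y w.
Proof.
rewrite mxE sum_pidx (bigD1 z) //= [X in _ + X]big1 => [|z' zz'].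
  rewrite addr0 [RHS]mxE; apply: eq_bigr => l _.
  rewrite adj_tensmx tensmxE adjmx1 !mxE eqxx mul1r; congr (_ * _).
  rewrite sum_pidx (bigD1 x) //= [X in _ + X]big1 => [|x' xx'].
    by rewrite addr0; apply: eq_bigr => k _; rewrite tensmxE !mxE eqxx mul1r.
  by rewrite big1 // => k _; rewrite tensmxE mxE eq_sym (negPf xx') !mul0r.
rewrite big1 // => l _.
by rewrite adj_tensmx tensmxE adjmx1 [_%:M _ _]mxE (negPf zz') mul0r mulr0.
Qed.

(* [T_al] is the [al]-th column of [B] read as an operator from the input to the reference. *)
Lemma idtensor_choi r m n s (K : 'M[C]_m -> 'M[C]_n) (B : 'M[C]_(r * m, s)) : (0 < m)%N ->
  let T al : 'M[C]_(r, m) := \matrix_(i, k) B (pidx i k) al in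
  idtensor K (B *m adjmx B) = \sum_al m%:R *:
    (tensmx (T al) 1%:M *m choi_state K *m adjmx (tensmx (T al) 1%:M)).
Proof.
move=> m0 T; apply: mx_pidxP => x y z w; rewrite idtensorE summxE.
under [RHS]eq_bigr => al _ do rewrite mxE conj_tens1E mulr_sumr.
rewrite [RHS]exchange_big; apply: eq_bigr => k _ /=.
under [RHS]eq_bigr => al _ do rewrite mulr_sumr.
rewrite [RHS]exchange_big; apply: eq_bigr => l _ /=.
rewrite mxE mulr_suml; apply: eq_bigr => al _.
rewrite adjmxE choi_stateE !mxE; field.
by rewrite pnatr_eq0 -lt0n.
Qed.

(** One direction of Choi's theorem: by [idtensor_choi] the output is a sum of conjugates of the
    Choi state. *)
Lemma psdmx_idtensor r m n (K : 'M[C]_m -> 'M[C]_n) (X : 'M[C]_(r * m)) : (0 < m)%N ->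
  psdmx (choi_state K) -> psdmx X -> psdmx (idtensor K X).
Proof.
move=> m0 pK /psdmx_gramP[B ->]; rewrite idtensor_choi //.
apply: psdmx_sum => al; apply: psdmxZ; first exact: ler0n.
exact: psdmx_conj.
Qed.

(** The transpose trick: [U^T] on the reference of the maximally entangled state acts like [U] on
    the input, which covariance turns into [V] on the output. *)
Lemma choi_state_cov m n (K : 'M[C]_m -> 'M[C]_n) U V : linear K ->
  (forall X, K (U *m X *m adjmx U) = V *m K X *m adjmx V) ->
  tensmx U^T 1%:M *m choi_state K *m adjmx (tensmx U^T 1%:M) =
  tensmx 1%:M V *m choi_state K *m adjmx (tensmx 1%:M V).
Proof.
move=> linK cov; apply: mx_pidxP => x y z w; rewrite conj_tens1E conj_1tensE.
have -> : \matrix_(k, l) choi_state K (pidx x k) (pidx z l) = m%:R^-1 *: K (delta_mx x z).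
  by apply/matrixP => k l; rewrite !mxE choi_stateE.
rewrite -scalemxAr -scalemxAl -cov mxE.
have -> : U *m delta_mx x z *m adjmx U =
    \sum_k \sum_l (U k x * conjc (U l z)) *: delta_mx k l.
  rewrite {1}(matrix_sum_delta (_ *m adjmx U)).
  apply: eq_bigr => k _; apply: eq_bigr => l _; congr (_ *: _).
  rewrite -(mul_delta_mx (0 : 'I_1)) mulmxA -mulmxA -colE -rowE mxE big_ord1.
  by rewrite !mxE.
rewrite (linmap_sum linK) summxE mulr_sumr; apply: eq_bigr => k _.
rewrite (linmap_sum linK) summxE mulr_sumr; apply: eq_bigr => l _.
by rewrite (linmapZ linK) choi_stateE !mxE; ring.
Qed.

(* The covariance moves the twirl of the input onto the output, where the quadratic
   forms do not see it; the twirled input has a maximally mixed marginal, hence is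
   the image of the maximally entangled state under a channel on the reference. *)
Lemma relent_choi_bound r m n (K L : 'M[C]_m -> 'M[C]_n) (J : finType)
    (U : J -> 'M[C]_m) (V : J -> 'M[C]_n) (rho : 'M[C]_(r * m)) :
  (0 < m)%N -> (0 < #|J|)%N -> (forall j, Defs.unitarymx (V j)) ->
  (forall X, #|J|%:R^-1 *: \sum_j U j *m X *m adjmx (U j) = (\tr X / m%:R) *: 1%:M) ->
  linear K -> linear L ->
  (forall j X, K (U j *m X *m adjmx (U j)) = V j *m K X *m adjmx (V j)) ->
  (forall j X, L (U j *m X *m adjmx (U j)) = V j *m L X *m adjmx (V j)) ->
  psdmx (choi_state K) -> psdmx (choi_state L) ->
  supp_le (choi_state K) (choi_state L) -> state rho ->
  (relent (idtensor K rho) (idtensor L rho) <= relent (choi_state K) (choi_state L))%E.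
Proof.
move=> m0 J0 uV design linK linL covK covL pK pL supp [prho tr_rho].
have pKr := psdmx_idtensor m0 pK prho; have pLr := psdmx_idtensor m0 pL prho.
have [B eB] := psdmx_gramP prho.
pose T al : 'M[C]_(r, m) := \matrix_(i, k) B (pidx i k) al.
(* The factor [m] comes from [idtensor_choi], the factor [1 / #|J|] is the weight of one label. *)
pose kap : C := ((Num.sqrt (m%:R / #|J|%:R : R))%:C)%C.
have kap2 : kap * conjc kap = m%:R / #|J|%:R.
  rewrite conjc_real -rmorphM /= -expr2 sqr_sqrtr ?divr_ge0 ?ler0n //.
  by rewrite rmorphM /= fmorphV /= !rmorph_nat.
have kap2' : conjc kap * kap = m%:R / #|J|%:R by rewrite mulrC.
have mn0 : (m%:R : C) != 0 by rewrite pnatr_eq0 -lt0n.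
have Jn0 : (#|J|%:R : C) != 0 by rewrite pnatr_eq0 -lt0n.
pose Kr j al := kap *: tensmx (T al *m (U j)^T) (1%:M : 'M[C]_n).
have KrE (M : 'M[C]_m -> 'M[C]_n) j : linear M ->
    (forall j X, M (U j *m X *m adjmx (U j)) = V j *m M X *m adjmx (V j)) ->
    \sum_al Kr j al *m choi_state M *m adjmx (Kr j al) =
    #|J|%:R^-1 *: (tensmx 1%:M (V j) *m idtensor M rho *m adjmx (tensmx 1%:M (V j))).
  move=> linM covM; rewrite eB idtensor_choi // mulmx_sumr mulmx_suml scaler_sumr.
  apply: eq_bigr => al _; rewrite /Kr adjmxZ -!scalemxAl -!scalemxAr -!scalemxAl.
  rewrite !scalerA kap2 -/(T al) mulrC; congr (_ *: _).
  have -> : tensmx (T al *m (U j)^T) 1%:M =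
      tensmx (T al) 1%:M *m tensmx (U j)^T 1%:M :> 'M[C]_(_, m * n).
    by rewrite tensmxM mulmx1.
  rewrite adjmxM.
  (* Once [U j] has become [V j] on the output, it commutes with [T al] on the reference. *)
  have /(congr1 (fun Y => tensmx (T al) 1%:M *m Y *m adjmx (tensmx (T al) 1%:M))) :=
    choi_state_cov linM (covM j).
  rewrite !mulmxA => ->; rewrite -/(T al).
  have -> : tensmx (T al) 1%:M *m tensmx 1%:M (V j) = tensmx 1%:M (V j) *m tensmx (T al) 1%:M.
    by rewrite !tensmxM !mulmx1 !mul1mx.
  rewrite -!mulmxA -!adjmxM; congr (_ *m (_ *m (_ *m adjmx _))).
  by rewrite !tensmxM !mulmx1 !mul1mx.
apply: (@relent_mono _ _ _ J 'I_(r * m) Kr (fun j => tensmx 1%:M (V j))) => //.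
- by move=> j; apply: tensmx_unitary => //; rewrite /Defs.unitarymx mul1mx adjmx1.
(* [Q] is the transpose of the reduced input state. Completeness of the Kraus operators is the
   transposed one-design identity at [Q^T], whose trace is 1. *)
- pose Q := \sum_al adjmx (T al) *m T al.
  have trQ : \tr Q = 1.
    rewrite -tr_rho eB mxtrace_mulC /Q raddf_sum; apply: eq_bigr => al _ /=.
    rewrite [RHS]mxE sum_pidx exchange_big; apply: eq_bigr => k _ /=.
    rewrite mxE; apply: eq_bigr => i _.
    by rewrite !adjmxE !mxE.
  transitivity (tensmx (\sum_j (conjc kap * kap) *:
      (adjmx (U j)^T *m Q *m (U j)^T)) (1%:M : 'M[C]_n)).
    rewrite tensmx_suml; apply: eq_bigr => j _.
    rewrite /Q mulmx_sumr mulmx_suml scaler_sumr tensmx_suml; apply: eq_bigr => al _.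
    rewrite /Kr adjmxZ -scalemxAl -scalemxAr scalerA tensmxZl adj_tensmx tensmxM adjmx1 mulmx1.
    by rewrite adjmxM !mulmxA.
  rewrite -scaler_sumr kap2'.
  have -> : \sum_j adjmx (U j)^T *m Q *m (U j)^T = (\sum_j U j *m Q^T *m adjmx (U j))^T.
    rewrite raddf_sum; apply: eq_bigr => j _ /=.
    by rewrite !trmx_mul trmxK mulmxA /adjmx !trmxK map_trmx trmxK.
  have := congr1 trmx (design Q^T); rewrite mxtrace_tr trQ !linearZ /= trmx1.
  by move=> dQ; rewrite -scalerA dQ scalerA mul1r divff // scale1r tensmx11.
- by move=> j; apply: KrE.
- by move=> j; apply: KrE.
Qed.

Lemma design_tens (G H : finType) m n (U : G -> 'M[C]_m) (V : H -> 'M[C]_n) :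
  (forall X, #|G|%:R^-1 *: \sum_g U g *m X *m adjmx (U g) = (\tr X / m%:R) *: 1%:M) ->
  (forall X, #|H|%:R^-1 *: \sum_h V h *m X *m adjmx (V h) = (\tr X / n%:R) *: 1%:M) ->
  forall X, #|{: G * H}|%:R^-1 *: \sum_(j : G * H)
     tensmx (U j.1) (V j.2) *m X *m adjmx (tensmx (U j.1) (V j.2)) =
    (\tr X / (m * n)%:R) *: 1%:M.
Proof.
move=> dU dV; apply: linear_tens_ext.
- move=> c X Y; rewrite scalerA mulrC -scalerA -scalerDr; congr (_ *: _).
  rewrite scaler_sumr -big_split; apply: eq_bigr => j _; exact: linear_conj.
- by move=> c X Y; rewrite linearD linearZ /= mulrDl scalerDl scalerA mulrA.
move=> A B; rewrite trace_tensmx card_prod natrM invfM.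
transitivity (tensmx (#|G|%:R^-1 *: \sum_g U g *m A *m adjmx (U g))
   (#|H|%:R^-1 *: \sum_h V h *m B *m adjmx (V h))).
  rewrite tensmxZl tensmxZr scalerA; congr (_ *: _).
  rewrite tensmx_suml.
  under [RHS]eq_bigr do rewrite tensmx_sumr.
  rewrite pair_bigA; apply: eq_bigr => j _ /=.
  by rewrite adj_tensmx !tensmxM.
by rewrite dU dV tensmxZl tensmxZr scalerA tensmx11 natrM invfM; congr (_ *: _); ring.
Qed.

(** Used to extend covariance from states to all operators: each nonzero [v *m adjmx v] is a
    multiple of a state, and polarization does the rest. *)
Lemma linear_state_ext m n (K L : 'M[C]_m -> 'M[C]_n) : linear K -> linear L ->
  (forall rho, state rho -> K rho = L rho) -> forall X, K X = L X.
Proof.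
move=> linK linL KL X; apply/eqP; rewrite -subr_eq0; apply/eqP; move: X.
apply: linear_rank1_eq0.
  move=> c X Y; rewrite linK linL scalerBr opprD addrACA; congr (_ + _).
move=> v; set t := \tr (v *m adjmx v).
have [t0|t0] := eqVneq t 0.
  by rewrite (trace_gram_eq0 t0) mul0mx (linmap0 linK) (linmap0 linL) subrr.
have -> : v *m adjmx v = t *: (t^-1 *: (v *m adjmx v)) by rewrite scalerA divff // scale1r.
rewrite (linmapZ linK) (linmapZ linL) KL ?subrr //; split.
  by apply: psdmxZ; [rewrite invr_ge0; apply: trace_gram_ge0 | apply: psdmx_gram].
by rewrite mxtraceZ mulVf.
Qed.

End ChoiState.

(** * Relative entropy to a product with a multiple of the identity *)

Section ConditionalEntropy.
Variable R : realType.
Local Notation C := (R[i]).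

(** From right to left: if [w] is in the kernel of the marginal, the nonnegative forms of [X] at the
    vectors [|j>|w>] sum to 0, so [X] annihilates each of them. *)
Lemma supp_le_tens m n (c : C) (X : 'M[C]_(m * n)) (S : 'M[C]_n) : c != 0 -> psdmx X ->
  supp_le X (tensmx (c *: 1%:M) S) <-> supp_le (ptrace1 X) S.
Proof.
move=> c0 pX; rewrite tensmxZl; split => supp v.
  move=> Sv; rewrite ptrace1_slice mulmx_suml big1 // => i _.
  rewrite -!mulmxA supp ?mulmx0 //.
  by rewrite -scalemxAl mulmxA tensmx_slice -mulmxA Sv mulmx0 scaler0.
rewrite -scalemxAl => /eqP; rewrite scaler_eq0 (negPf c0) /= => /eqP Sv.
rewrite -[v]mul1mx -sum_slice mulmx_suml mulmx_sumr big1 // => i _.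
have Si : S *m (slice R n i *m v) = 0 by rewrite mulmxA -slice_tensmx -mulmxA Sv mulmx0.
rewrite -mulmxA; have := supp _ Si; move: (slice R n i *m v) => w pw.
have ge0 j : 0 <= \tr (adjmx (adjmx (slice R n j) *m w) *m X *m (adjmx (slice R n j) *m w)).
  by rewrite -{2}[_ *m w]adjmxK; apply: trace_psd_gram_ge0.
apply: psdmx_ker => //.
have : \sum_j \tr (adjmx (adjmx (slice R n j) *m w) *m X *m (adjmx (slice R n j) *m w)) = 0.
  transitivity (\tr (adjmx w *m (ptrace1 X *m w))); last by rewrite pw mulmx0 raddf0.
  rewrite ptrace1_slice mulmx_suml mulmx_sumr raddf_sum; apply: eq_bigr => j _.
  by rewrite adjmxM adjmxK !mulmxA.
by move/eqP; rewrite psumr_eq0 // => /allP /(_ i (mem_index_enum _)) /= /eqP.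
Qed.

Lemma mxfun_tens m n (f : R -> R) (c : R) (S : 'M[C]_n) : psdmx S ->
  mxfun f (tensmx ((c%:C)%C *: 1%:M) S) =
  tensmx (1%:M : 'M[C]_m) (mxfun (fun x => f (c * x)) S).
Proof.
move=> /psdmx_spectral[[U d] ep _].
pose e : 'rV[R]_(m * n) := mxvec (\matrix_(i < m, k < n) (c * d 0 k)).
have diagE (g : R -> R) : diag_mx (map_mx (fun x => ((g x)%:C)%C) e) =
    tensmx (1%:M : 'M[C]_m) (diag_mx (map_mx (fun x => ((g (c * x))%:C)%C) d)).
  apply: mx_pidxP => i k j l; rewrite tensmxE !mxE pidx_eq.
  have -> : e 0 (pidx i k) = c * d 0 k by rewrite /e /pidx mxvecE mxE.
  by case: (i == j); case: (k == l); rewrite /= ?mulr1n ?mulr0n ?mul1r ?mul0r ?mulr0.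
have ee : eigdec (tensmx ((c%:C)%C *: 1%:M) S) (tensmx (1%:M : 'M[C]_m) U, e).
  case: ep => /= uU ->; split => /=.
    by apply: tensmx_unitary => //; rewrite /Defs.unitarymx mul1mx adjmx1.
  rewrite (diagE id) adj_tensmx !tensmxM adjmx1 !mulmx1 tensmxZl -tensmxZr.
  congr tensmx; rewrite scalemxAl scalemxAr; congr (_ *m _ *m _).
  apply/matrixP => k l; rewrite !mxE rmorphM /=.
  by case: (k == l); rewrite ?mulr1n ?mulr0n ?mulr0.
rewrite (mxfun_eigdec f ee) (mxfun_eigdec _ ep) /= diagE adj_tensmx !tensmxM.
by rewrite adjmx1 !mulmx1.
Qed.

(** The logarithm of the second argument splits into [ln c] and the logarithm of [S], which only
    sees the marginal; the entropy of the marginal is added and subtracted. *)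
Lemma relent_tens m n (c : R) (X : 'M[C]_(m * n)) (S : 'M[C]_n) : 0 < c ->
  psdmx X -> \tr X = 1 -> psdmx S ->
  (relent X (tensmx ((c%:C)%C *: 1%:M) S) =
   (- condentropy X - ln c)%:E + relent (ptrace1 X) S)%E.
Proof.
move=> c0 pX trX pS; have pX1 := psdmx_ptrace1 pX.
have c0' : (c%:C)%C != 0 :> C by rewrite fmorph_eq0 lt0r_neq0.
rewrite /relent; have iff := supp_le_tens S c0' pX.
rewrite (asbool_equiv_eq iff); case: asboolP => [supp|_]; last by rewrite addey.
rewrite -EFinD; congr EFin.
rewrite /mxlog mxfun_tens // !mulmxBr !linearB /=.
rewrite trace_tensmx1 /condentropy /vNentropy.
have [r er r0] := psdmx_spectral pX1; have [s es s0] := psdmx_spectral pS.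
have trE f : complex.Re (\tr (ptrace1 X *m mxfun f S)) = overlap_sum r s (fun p q => p * f q).
  rewrite -{1}(mxfun_id pX1) (mxfun_eigdec _ er) (mxfun_eigdec _ es) trace_mxdec_overlap /=.
  by rewrite -!surjective_pairing.
have -> : complex.Re (\tr (ptrace1 X *m mxfun (fun x => logsupp (c * x)) S)) =
    complex.Re (\tr (ptrace1 X *m mxfun (@logsupp R) S)) + ln c.
  have -> : ln c = overlap_sum r s (fun p _ => p) * ln c.
    by rewrite -(trace_overlap pX1 er es.1) trace_ptrace1 trX mul1r.
  rewrite !trE /overlap_sum mulr_suml -big_split; apply: eq_bigr => i _.
  rewrite mulr_suml -big_split; apply: eq_bigr => j _ /=.
  (* [logsupp (c * q)] splits only for [q > 0]; at [q = 0] with nonzero weight, the support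
     condition gives [p = 0]. *)
  have [->|o0] := eqVneq (overlap r.1 s.1 i j) 0; first by rewrite !mul0r addr0.
  rewrite -mulrA -mulrDr; congr (_ * _).
  have := supp_le_overlap supp er es o0.
  have := s0 j; rewrite le_eqVlt => /orP[/eqP <- /(_ erefl) ->|q0 _].
    by rewrite !mul0r addr0.
  by rewrite /logsupp q0 pmulr_rgt0 // q0 lnM ?posrE // mulrDr addrC.
by rewrite /mxlog; ring.
Qed.

Lemma relentxx n (rho : 'M[C]_n) : relent rho rho = 0%E.
Proof.
by rewrite /relent asboolT // subrr mulmx0 raddf0.
Qed.

Lemma psdmx_tens1 m n (c : R) (S : 'M[C]_n) : 0 <= c -> psdmx S ->
  psdmx (tensmx ((c%:C)%C *: (1%:M : 'M[C]_m)) S).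
Proof.
move=> c0 /psdmx_gramP[B ->]; rewrite tensmxZl; apply: psdmxZ; first by rewrite ler0c.
have -> : tensmx (1%:M : 'M[C]_m) (B *m adjmx B) = tensmx 1%:M B *m adjmx (tensmx 1%:M B).
  by rewrite adj_tensmx tensmxM mul1mx adjmx1.
exact: psdmx_gram.
Qed.

Lemma psdmx_mid_swap p q s t (X : 'M[C]_((p * q) * (s * t))) :
  psdmx X -> psdmx (mid_swap X).
Proof.
have [P [_ _ ->]] := mid_swap_unitary R p q s t; exact: psdmx_conj.
Qed.

Lemma relent_mid_swap p q s t (X Y : 'M[C]_((p * q) * (s * t))) : psdmx X -> psdmx Y ->
  relent (mid_swap X) (mid_swap Y) = relent X Y.
Proof.
by have [P [P1 P2 PE]] := mid_swap_unitary R p q s t => pX pY; rewrite !PE relent_conj.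
Qed.

Lemma trace_mid_swap p q s t (X : 'M[C]_((p * q) * (s * t))) : \tr (mid_swap X) = \tr X.
Proof.
have [P [_ P2 ->]] := mid_swap_unitary R p q s t.
by rewrite mxtrace_mulC mulmxA P2 mul1mx.
Qed.

End ConditionalEntropy.

(** * Lower bound for every channel, and optimality of the local channel under tele-covariance *)

Section TeleCovariant.
Variables (R : realType) (a' b' a b : nat).
Local Notation C := (R[i]).
Hypotheses (a'0 : (0 < a')%N) (b'0 : (0 < b')%N).

Lemma choi_choi_state (N : 'M[C]_(a' * b') -> 'M[C]_(a * b)) :
  choi N = mid_swap (choi_state N).
Proof. by rewrite /choi maxent_prod. Qed.

Lemma choi_state_Rmap (M : 'M[C]_b' -> 'M[C]_b) : linear M ->
  choi_state (tmap (@Rmap R a' a) M) =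
  mid_swap (tensmx ((((a'%:R : R)^-1)%:C)%C *: 1%:M) (choi_state M)).
Proof.
move=> linM; rewrite -[LHS]mid_swapK; congr mid_swap.
apply: mx_pidxP => u v u' v'.
case/mxvec_indexP: u => x y; case/mxvec_indexP: v => z w.
case/mxvec_indexP: u' => x' y'; case/mxvec_indexP: v' => z' w'.
rewrite mid_swapE choi_stateE -tensmx_delta tmap_tens //; last exact: Rmap_linear.
have ZE p q (c : C) (A : 'M[C]_(p, q)) i j : (c *: A) i j = c * A i j by rewrite mxE.
have E1 p (i j : 'I_p) : (1%:M : 'M[C]_p) i j = (i == j)%:R by rewrite mxE.
rewrite !tensmxE choi_stateE /Rmap !ZE !E1 pidx_eq natrM invfM fmorphV /= rmorph_nat.
have -> : \tr (delta_mx x x') = (x == x')%:R :> C.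
  rewrite /mxtrace (bigD1 x) //= big1 ?mxE ?eqxx ?addr0 // => j jx.
  by rewrite mxE (negPf jx).
by rewrite -mulnb natrM; ring.
Qed.

Variable N : 'M[C]_(a' * b') -> 'M[C]_(a * b).
Hypothesis chN : channel N.

(** The optimizer [M0]: feed the maximally mixed state into the first input and discard the first
    output. *)
Definition local_channel (Y : 'M[C]_b') : 'M[C]_b :=
  a'%:R^-1 *: ptrace1 (N (tensmx 1%:M Y)).

Lemma local_channel_linear : linear local_channel.
Proof.
have [[linN _] _] := chN; move=> c X Y.
rewrite /local_channel tensmxDr tensmxZr linN ptrace1_linear scalerDr !scalerA.
by rewrite mulrC.
Qed.

Lemma choi_state_psd : psdmx (choi_state N).
Proof.
have [[_ cpN] _] := chN; apply: cpN.
by case: (@maxent_state R (a' * b')); rewrite ?muln_gt0 ?a'0.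
Qed.

Lemma choi_psd : psdmx (choi N).
Proof. by rewrite choi_choi_state; apply: psdmx_mid_swap; apply: choi_state_psd. Qed.

Lemma choi_state_local_channel : choi_state local_channel = ptrace1 (choi N).
Proof.
have [[linN _] _] := chN; rewrite choi_choi_state.
apply: mx_pidxP => z w z' w'; rewrite choi_stateE [RHS]mxE sum_pidx /local_channel.
have -> : tensmx (1%:M : 'M[C]_a') (delta_mx z z') = \sum_x delta_mx (pidx x z) (pidx x z').
  under eq_bigr do rewrite -tensmx_delta.
  rewrite -tensmx_suml; congr tensmx; rewrite [LHS]matrix_sum_delta.
  apply: eq_bigr => i _; rewrite (bigD1 i) //= big1 ?mxE ?eqxx ?scale1r ?addr0 // => j ji.
  by rewrite mxE eq_sym (negPf ji) scale0r.
rewrite (linmap_sum linN) !mxE mulrA mulr_sumr exchange_big; apply: eq_bigr => y _ /=.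
rewrite summxE mulr_sumr; apply: eq_bigr => x _.
by rewrite mid_swapE choi_stateE natrM invfM [b'%:R^-1 * _]mulrC.
Qed.

Lemma local_channel_channel : channel local_channel.
Proof.
have [[linN _] trN] := chN; split; first split.
- exact: local_channel_linear.
- move=> r X; apply: psdmx_idtensor => //.
  by rewrite choi_state_local_channel; apply: psdmx_ptrace1; apply: choi_psd.
move=> Y; rewrite /local_channel mxtraceZ trace_ptrace1 trN trace_tensmx mxtrace1 mulrA.
by rewrite mulVf ?mul1r // pnatr_eq0 -lt0n.
Qed.

(** An instance of [relent_tens] with [c = 1 / a']. The last term is nonnegative for every [M] and
    vanishes at the optimizer, which yields the two bounds. *)
Lemma relent_choi_state (M : 'M[C]_b' -> 'M[C]_b) : channel M ->
  (relent (choi_state N) (choi_state (tmap (@Rmap R a' a) M)) =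
   (- (condentropy (choi N) - ln a'%:R))%:E
     + relent (choi_state local_channel) (choi_state M))%E.
Proof.
move=> [[linM cpM] trM]; have [_ trN] := chN.
have pM : psdmx (choi_state M) by apply: cpM; case: (maxent_state R b'0).
have a'R : 0 < a'%:R :> R by rewrite ltr0n.
have c0 : 0 < (a'%:R)^-1 :> R by rewrite invr_gt0.
rewrite choi_state_Rmap // -relent_mid_swap; first last.
- by apply: psdmx_mid_swap; apply: psdmx_tens1 => //; apply: ltW.
- exact: choi_state_psd.
have tr1 : \tr (choi N) = 1.
  by rewrite choi_choi_state trace_mid_swap trace_choi_state // muln_gt0 a'0.
rewrite mid_swapK -choi_choi_state (relent_tens c0 choi_psd tr1 pM).
rewrite choi_state_local_channel lnV ?posrE //.
by congr (_%:E + _)%E; ring.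
Qed.

Lemma chdiv_ge (M : 'M[C]_b' -> 'M[C]_b) : channel M ->
  ((- (condentropy (choi N) - ln a'%:R))%:E <= chdiv N (tmap (@Rmap R a' a) M))%E.
Proof.
move=> chM; apply: (@le_trans _ _
  (relent (choi_state N) (choi_state (tmap (@Rmap R a' a) M)))).
  rewrite relent_choi_state // leeDl //; apply: relent_ge0.
  - by rewrite choi_state_local_channel; apply: psdmx_ptrace1; apply: choi_psd.
  - by have [[_ cpM] _] := chM; apply: cpM; case: (maxent_state R b'0).
  have [_ tr0] := local_channel_channel; have [_ trM] := chM.
  by rewrite !trace_choi_state.
apply: ereal_sup_ubound; exists (a' * b')%N, (maxent R (a' * b')); split => //.
by apply: maxent_state; rewrite muln_gt0 a'0.
Qed.

Hypothesis covN : tele_covariant N.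

Lemma chdiv_local_channel_le :
  (chdiv N (tmap (@Rmap R a' a) local_channel) <=
   (- (condentropy (choi N) - ln a'%:R))%:E)%E.
Proof.
have chM := local_channel_channel; have linM := local_channel_linear.
have [[linN _] _] := chN.
set L := tmap _ _; have linL : linear L by apply: tmap_linear.
have relN : (relent (choi_state N) (choi_state L) =
    (- (condentropy (choi N) - ln a'%:R))%:E)%E.
  by rewrite relent_choi_state // relentxx adde0.
(* The relative entropy is finite by [relN], which forces the support inclusion. *)
have supp : supp_le (choi_state N) (choi_state L).
  by move: relN; rewrite /relent; case: asboolP.
have [G [H [UA [UB [VA [WB [[uUA [UA1 _]] [uUB _] [uVA _] [uWB _]
  [dUA dUB cov]]]]]]]] := covN.
pose U (j : G * H) := tensmx (UA j.1) (UB j.2).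
pose V (j : G * H) := tensmx (VA j.1) (WB j.2).
have covNX j X : N (U j *m X *m adjmx (U j)) = V j *m N X *m adjmx (V j).
  move: X; apply: linear_state_ext => [||rho]; last exact: cov.
    by apply: linear_comp_map => //; apply: linear_conj.
  by apply: (linear_comp_map (@linear_conj _ _ _ (V j))).
(* Covariance of [N] at the pair [(1, h)], where [UA 1] is the identity; the unitary [VA 1]
   disappears under the partial trace. *)
have covM h Y : local_channel (UB h *m Y *m adjmx (UB h)) =
    WB h *m local_channel Y *m adjmx (WB h).
  rewrite /local_channel -scalemxAr -scalemxAl; congr (_ *: _).
  rewrite -(ptrace1_conj _ _ (uVA 1%g)) -(covNX (1%g, h)) /U /= UA1.
  by rewrite adj_tensmx !tensmxM adjmx1 !mulmx1.
(* On the first factor [L] outputs the identity, which conjugation by [VA] fixes. *)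
have covLX j X : L (U j *m X *m adjmx (U j)) = V j *m L X *m adjmx (V j).
  rewrite /L !tmap_Rmap // ptrace1_conj // covM /V adj_tensmx !tensmxM mulmx1.
  by rewrite uVA.
rewrite -relN; apply: ge_ereal_sup => x [r [rho [st_rho ->]]].
apply: (relent_choi_bound (U := U) (V := V)) => //.
- by rewrite muln_gt0 a'0.
- by apply/card_gt0P; exists (1%g, 1%g).
- by move=> j; apply: tensmx_unitary.
- exact: design_tens.
- exact: choi_state_psd.
rewrite choi_state_Rmap //; apply: psdmx_mid_swap; apply: psdmx_tens1.
  by rewrite invr_ge0 ler0n.
by rewrite choi_state_local_channel; apply: psdmx_ptrace1; apply: choi_psd.
Qed.

End TeleCovariant.

Theorem mainTheorem6 (R : realType) (a' b' a b : nat)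
  (N : 'M[R[i]]_(a' * b') -> 'M[R[i]]_(a * b)) :
  (0 < a')%N -> (0 < b')%N -> (0 < a)%N -> (0 < b)%N ->
  channel N -> tele_covariant N ->
  chcondentropy N = (condentropy (choi N) - ln (a'%:R))%:E.
Proof.
move=> a'0 b'0 _ _ chN covN; rewrite /chcondentropy.
suff -> : ereal_inf [set x | exists M : 'M[R[i]]_b' -> 'M[R[i]]_b,
      channel M /\ x = chdiv N (tmap (@Rmap R a' a) M)]%classic =
    (- (condentropy (choi N) - ln (a'%:R)))%:E by rewrite EFinN oppeK.
apply/eqP; rewrite eq_le; apply/andP; split.
  apply: le_trans (chdiv_local_channel_le a'0 b'0 chN covN).
  apply: ereal_inf_lbound; exists (local_channel N); split => //.
  exact: local_channel_channel.
by apply: le_ereal_inf_tmp => x [M [chM ->]]; apply: chdiv_ge.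
Qed.
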